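(* The vertical cohomology groups $H^i_{\mathcal F'}(Q'^{3})$ ($i=0,1,2$) are a topological invariant of completely integrable, in the Bott sense, nonresonance Hamiltonian systems $v=\operatorname{sgrad}H$ on isoenergetic surfaces $Q^3$. That is, if $v_1$ and $v_2$ are two such systems on the oriented isoenergetic surfaces $Q_1^3$ and $Q_2^3$, respectively, and they are topologically equivalent, then $H^i_{\mathcal F_1'}(Q_1'^{3})\cong H^i_{\mathcal F_2'}(Q_2'^{3})$ for all $i$.
   Context: Vertical cohomologies. For a foliation $\mathcal F$ of a smooth manifold $M$ with tangent distribution $V\subset TM$, let $S(V)$ be the smooth vector fields tangent to the leaves and $\Lambda^p_{\mathcal F}(M)$ the module of smooth sections of the bundle of exterior $p$-forms on $V$ (equivalently, alternating $C^\infty(M)$-multilinear maps $S(V)^p\to C^\infty(M)$), with differential $$(d_{\mathcal F}^p\alpha)(X_1,\dots,X_{p+1})=\sum_{i}(-1)^{i-1}X_i\alpha(X_1,\dots,\widehat X_i,\dots,X_{p+1})+\sum_{i<j}(-1)^{i+j}\alpha([X_i,X_j],X_1,\dots,\widehat X_i,\dots,\widehat X_j,\dots,X_{p+1}).$$ $H^*_{\mathcal F}(M)$ is the cohomology of $(\Lambda^*_{\mathcal F}(M),d^*_{\mathcal F})$. Hamiltonian systems. Let $v=\operatorname{sgrad}H$ be a Hamiltonian system on a symplectic 4-manifold $(M^4,\omega)$, let $h$ be a regular value of $H$, and let $Q^3=\{H=h\}$ be the isoenergetic surface, assumed to be a closed manifold; the restriction of the system to $Q^3$ is also denoted $v$.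 The system is (completely) integrable if there is an additional smooth first integral $f$ in involution with $H$ and independent of $H$ almost everywhere. It is integrable in the Bott sense if such an $f$ can be chosen to be a Bott function on $Q^3$, i.e. all critical points of $f|_{Q^3}$ form nondegenerate critical submanifolds (the restriction of $f$ to each normal plane has a nondegenerate Morse singularity). The connected components of regular level surfaces of $f$ on $Q^3$ are Liouville tori $T^2$. Connected components of critical level surfaces are of the following types: (1) a torus $T^2$; (2) a Klein bottle $K^2$; (3) a circle $S^1$ (in cases (1)–(3) consisting entirely of critical points of $f$ at which a maximum or minimum is attained); (4) a piecewise smooth two-dimensional polyhedron with singularities of the type of a transversal intersection of two planes, along ''saddle'' critical circles of $f$. The system is nonresonance on $Q^3$ if the set of Liouville tori with irrational windings is everywhere dense in $Q^3$. The Liouville foliation $\mathcal F$ on $Q^3$ is the partition of $Q^3$ into Liouville tori and (connected components of) critical level surfaces of the Bott integral $f$; it does not depend on the choice of $f$. $Q'^3$ is the open manifold obtained from $Q^3$ by removing all critical circles of $f$ (maximal, minimal and saddle-type), and $\mathcal F'$ is the two-dimensional (genuine) foliation induced on $Q'^3$ by $\mathcal F$. Two integrable, in the Bott sense, nonresonance systems $v_1,v_2$ on oriented $Q_1^3,Q_2^3$ are topologically equivalent if there is an orientation preserving diffeomorphism $g:Q_1^3\to Q_2^3$ which transforms the Liouville tori of $v_1$ to those of $v_2$ (critical tori being counted among the Liouville tori), and the isolated critical circles to the isolated critical circles with the same orientation, where the critical circles are oriented by the fields $v_1$, $v_2$. (Such a $g$ is a leaf-to-leaf mapping between the Liouville foliated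 manifolds.) *)

(* Defs.v *)
From HB Require Import structures.
From mathcomp Require Import all_boot all_order all_algebra.
From mathcomp Require Import all_classical all_reals all_analysis.
From mathcomp Require Import ring.

Set Implicit Arguments.
Unset Strict Implicit.
Unset Printing Implicit Defensive.

Import Order.TTheory GRing.Theory Num.Theory.
Import numFieldNormedType.Exports.
Local Open Scope classical_set_scope.
Local Open Scope ring_scope.

Section ModuleQuotient.
Variables (K : pzRingType) (V : lmodType K) (I : zmodClosed V).
Variable IZ : GRing.scaler_closed I.
Local Open Scope quotient_scope.
Local Notation Q := (Quotient.quot I).

Definition mod_quot of GRing.scaler_closed I := Q.
Local Notation MQ := (mod_quot IZ).
HB.instance Definition _ := GRing.Zmodule.on MQ.

Definition mod_quot_scale (a : K) (x : MQ) : MQ :=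
  \pi_Q (a *: repr (x : Q)).

Lemma mod_quot_scaleE a (v : V) :
  mod_quot_scale a (\pi_Q v) = \pi_Q (a *: v).
Proof.
apply/eqP; rewrite /mod_quot_scale -Quotient.idealrBE -scalerBr.
by apply: IZ; rewrite Quotient.idealrBE reprK.
Qed.

Fact mod_quot_scaleA a b x :
  mod_quot_scale a (mod_quot_scale b x) = mod_quot_scale (a * b) x.
Proof. by rewrite -[x](@reprK _ Q) !mod_quot_scaleE scalerA. Qed.
Fact mod_quot_scale1 : left_id 1 mod_quot_scale.
Proof.
by move=> x; rewrite -[x in LHS](@reprK _ Q) mod_quot_scaleE scale1r reprK.
Qed.
Fact mod_quot_scaleDr : right_distributive mod_quot_scale +%R.
Proof.
move=> a x y; rewrite -[x](@reprK _ Q) -[y](@reprK _ Q).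
have piD (u v : V) : \pi_Q u + \pi_Q v = \pi_Q (u + v) by rewrite !piE.
by rewrite [X in mod_quot_scale _ X]piD !mod_quot_scaleE scalerDr -piD.
Qed.
Fact mod_quot_scaleDl x :
  {morph mod_quot_scale^~ x : a b / a + b}.
Proof.
move=> a b; rewrite -[x](@reprK _ Q) !mod_quot_scaleE scalerDl.
by rewrite -[RHS]/(\pi_Q _ + \pi_Q _) !piE.
Qed.

HB.instance Definition _ := GRing.Zmodule_isLmodule.Build K MQ
  mod_quot_scaleA mod_quot_scale1 mod_quot_scaleDr mod_quot_scaleDl.

End ModuleQuotient.

Fixpoint Ck_on (R : realType) (n k : nat) (V : set 'rV[R]_n)
    (f : 'rV[R]_n -> R) : Prop :=
  if k is k'.+1 then
    (forall p, V p -> differentiable f p) /\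
    (forall i : 'I_n, Ck_on k' V (fun p => 'D_(delta_mx 0 i) f p))
  else forall p, V p -> {for p, continuous f}.

Definition Cinfty_on (R : realType) (n : nat) (V : set 'rV[R]_n)
    (f : 'rV[R]_n -> R) : Prop := forall k, Ck_on k V f.

(* Functional structures (Sikorski, Bredon): a topological space together with
   the ring of its smooth functions, where smoothness is a local property.
   A manifold is then such a space that is locally isomorphic to R^n with its
   C^oo functions, see [manifold]. *)
Record smooth_space (R : realType) := SmoothSpace {
  carrier :> topologicalType;
  smooth : set (carrier -> R);
  smooth_cst : forall c : R, smooth (cst c);
  smoothB : forall f g, smooth f -> smooth g -> smooth (f - g);
  smoothM : forall f g, smooth f -> smooth g -> smooth (f * g);
  smooth_local : forall f : carrier -> R,
    (forall x : carrier, exists2 g, smooth g & \forall y \near x, f y = g y) ->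
    smooth f
}.

Section SmoothFunctions.
Variables (R : realType) (D : smooth_space R).

Definition smooth_pred : pred (D -> R) := fun f => `[< smooth f >].

Fact smooth_pred_subring : subring_closed smooth_pred.
Proof.
split; first by apply/asboolP/smooth_cst.
- by move=> f g /asboolP fs /asboolP gs; apply/asboolP/smoothB.
- by move=> f g /asboolP fs /asboolP gs; apply/asboolP/smoothM.
Qed.
Fact smooth_pred_submod : subsemimod_closed smooth_pred.
Proof.
have scale a f : smooth f -> smooth (a *: f).
  by move=> fs; apply: (smoothM (smooth_cst _ a) fs).
have add f g : smooth f -> smooth g -> smooth (f + g).
  move=> fs gs; rewrite -[g]opprK; apply: smoothB => //.
  by rewrite -scaleN1r; exact: scale.
split; last by move=> a f /asboolP fs; apply/asboolP/scale.
split; first by apply/asboolP/smooth_cst.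
by move=> f g /asboolP fs /asboolP gs; apply/asboolP/add.
Qed.

Record cinf := Cinf { cinf_fun :> D -> R; _ : smooth_pred cinf_fun }.
HB.instance Definition _ := [isSub for cinf_fun].
HB.instance Definition _ := [Choice of cinf by <:].
HB.instance Definition _ :=
  GRing.SubChoice_isSubComPzRing.Build _ _ cinf smooth_pred_subring.
HB.instance Definition _ :=
  GRing.SubZmodule_isSubLmodule.Build R _ _ cinf smooth_pred_submod.

Definition mk_cinf (f : D -> R) (fs : smooth f) : cinf :=
  Cinf (introT (asboolP _) fs).

Lemma cinfP (f : cinf) : smooth f.
Proof. by case: f => f fs; apply/asboolP. Qed.

Lemma cinf_scaleE (a : R) (h u v : cinf) :
  h * (a *: u + v) = a *: (h * u) + h * v.
Proof.
have E (b k r s : R) : k * (b * r + s) = b * (k * r) + k * s by ring.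
by apply/val_inj/funext => x; exact: E.
Qed.

Definition smooth_at (f : D -> R) (x : D) : Prop :=
  exists2 g, smooth g & \forall y \near x, f y = g y.

End SmoothFunctions.

(* The structure induced on a subset: the functions that locally extend to
   smooth functions of the ambient space. *)
Section SubSpace.
Variables (R : realType) (D : smooth_space R) (A : set D).

Definition sub_smooth : set (A -> R) := [set f | forall x : A,
  exists2 g, smooth g & \forall y \near x, f y = g (set_val y)].

Fact sub_smooth_cst c : sub_smooth (cst c).
Proof.
by move=> x; exists (cst c); [exact: smooth_cst|exact: (@nearW _ (nbhs x))].
Qed.
Fact sub_smoothB f g : sub_smooth f -> sub_smooth g -> sub_smooth (f - g).
Proof.
move=> fs gs x; have [f' f's ff'] := fs x; have [g' g's gg'] := gs x.
exists (f' - g'); first exact: smoothB.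
by near=> y; congr (_ - _); near: y.
Unshelve. all: by end_near. Qed.
Fact sub_smoothM f g : sub_smooth f -> sub_smooth g -> sub_smooth (f * g).
Proof.
move=> fs gs x; have [f' f's ff'] := fs x; have [g' g's gg'] := gs x.
exists (f' * g'); first exact: smoothM.
by near=> y; congr (_ * _); near: y.
Unshelve. all: by end_near. Qed.
Fact sub_smooth_local (f : A -> R) :
  (forall x : A, exists2 g, sub_smooth g & \forall y \near x, f y = g y) ->
  sub_smooth f.
Proof.
move=> fl x; have [g gs fg] := fl x; have [h hs gh] := gs x.
exists h => //; near=> y.
have -> : f y = g y by near: y.
by near: y.
Unshelve. all: by end_near. Qed.

Definition sub_space : smooth_space R :=
  SmoothSpace sub_smooth_cst sub_smoothB sub_smoothM sub_smooth_local.

Fact restrict_smooth (f : cinf D) : smooth (fun x : sub_space => f (set_val x)).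
Proof. by move=> x; exists f; [exact: cinfP|exact: (@nearW _ (nbhs x))]. Qed.

Definition restrict (f : cinf D) : cinf sub_space :=
  mk_cinf (restrict_smooth f).

End SubSpace.

Section Manifolds.
Variables (R : realType) (D : smooth_space R).

Record chart (n : nat) := Chart {
  chart_dom : set D;
  chart_map : D -> 'rV[R]_n;
  chart_inv : 'rV[R]_n -> D;
  chart_open : open chart_dom;
  chart_open_image : open (chart_map @` chart_dom);
  chartK : forall x, chart_dom x -> chart_inv (chart_map x) = x;
  chart_map_continuous :
    forall x, chart_dom x -> {for x, continuous chart_map};
  chart_inv_continuous :
    forall p, (chart_map @` chart_dom) p -> {for p, continuous chart_inv};
  chart_smooth : forall g : D -> R,
    (forall x, chart_dom x -> smooth_at g x) <->
    Cinfty_on (chart_map @` chart_dom) (g \o chart_inv)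
}.

Definition manifold (n : nat) : Prop :=
  [/\ hausdorff_space D, @second_countable D &
      forall x : D, exists c : chart n, chart_dom c x].

Definition tangent_vector (x : D) (xi : cinf D -> R) : Prop :=
  (forall (a : R) f g, xi (a *: f + g) = a * xi f + xi g) /\
  (forall f g, xi (f * g) = xi f * g x + f x * xi g).

Definition critical (f : cinf D) : set D :=
  [set x | forall xi, tangent_vector x xi -> xi f = 0].

Definition derivation (X : cinf D -> (cinf D)^o) : Prop :=
  (forall (a : R) f g, X (a *: f + g) = a *: (X f : cinf D) + X g) /\
  (forall f g : cinf D, X (f * g) = (X f : cinf D) * g + f * (X g : cinf D)).

Definition derivation_pred : pred (cinf D -> (cinf D)^o) :=
  fun X => `[< derivation X >].

Fact derivation_submod : subsemimod_closed derivation_pred.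
Proof.
have linE (a : R) (u v w t : cinf D) :
    a *: u + v + (a *: w + t) = a *: (u + w) + (v + t).
  by rewrite scalerDr addrACA.
have leibE (f g u v w t : cinf D) :
    u * g + f * v + (w * g + f * t) = (u + w) * g + f * (v + t).
  by rewrite mulrDl mulrDr addrACA.
have mulE (h f g u v : cinf D) : h * (u * g + f * v) = h * u * g + f * (h * v).
  by rewrite mulrDr mulrA mulrCA.
split; first split.
- apply/asboolP; split=> [a f g|f g].
    have E (b : R) : (0 : cinf D) = b *: 0 + 0 by rewrite scaler0 addr0.
    exact: E.
  have E (u v : cinf D) : 0 = 0 * v + u * 0 by rewrite mul0r mulr0 addr0.
  exact: E.
- move=> X Y /asboolP[Xl XM] /asboolP[Yl YM]; apply/asboolP.
  split=> [a f g|f g]; rewrite -[LHS]/((X _ : cinf D) + (Y _ : cinf D)).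
    by rewrite Xl Yl; exact: linE.
  by rewrite XM YM; exact: leibE.
- move=> h X /asboolP[Xl XM]; apply/asboolP.
  split=> [a f g|f g]; rewrite -[LHS]/(h * (X _ : cinf D)).
    by rewrite Xl; exact: cinf_scaleE.
  by rewrite XM; exact: mulE.
Qed.

Record vfield :=
  VField { vfield_fun :> cinf D -> (cinf D)^o; _ : derivation_pred vfield_fun }.
HB.instance Definition _ := [isSub for vfield_fun].
HB.instance Definition _ := [Choice of vfield by <:].
HB.instance Definition _ :=
  GRing.SubChoice_isSubLmodule.Build _ _ _ vfield derivation_submod.

Lemma vfieldP (X : vfield) : derivation X.
Proof. by case: X => X dX; apply/asboolP. Qed.

Fact bracket_derivation (X Y : vfield) :
  derivation (fun f => X (Y f) - Y (X f)).
Proof.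
have [Xl XM] := vfieldP X; have [Yl YM] := vfieldP Y.
have XD (f g : cinf D) : X (f + g) = (X f : cinf D) + X g.
  by rewrite -[f]scale1r Xl !scale1r.
have YD (f g : cinf D) : Y (f + g) = (Y f : cinf D) + Y g.
  by rewrite -[f]scale1r Yl !scale1r.
have linE (a : R) (u v w t : cinf D) :
    a *: u + v - (a *: w + t) = a *: (u - w) + (v - t).
  by rewrite opprD addrACA scalerBr.
have leibE (f g u v w t r s : cinf D) :
    u * g + v + (w + f * t) - (r * g + w + (v + f * s)) =
    (u - r) * g + f * (t - s).
  have E (f1 g1 u1 v1 w1 t1 r1 s1 : R) : u1 * g1 + v1 + (w1 + f1 * t1)
    - (r1 * g1 + w1 + (v1 + f1 * s1)) = (u1 - r1) * g1 + f1 * (t1 - s1) by ring.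
  by apply/val_inj/funext => x; exact: E.
split=> [a f g|f g].
  by rewrite (Yl a f g) (Xl a f g) (Xl a (Y f)) (Yl a (X f)); exact: linE.
rewrite (YM f g) (XM f g) (XD (Y f * g)) (YD (X f * g)).
rewrite (XM (Y f)) (XM f) (YM (X f)) (YM f); exact: leibE.
Qed.

Definition bracket (X Y : vfield) : vfield :=
  VField (introT (asboolP _) (bracket_derivation X Y)).

End Manifolds.

Section VerticalCohomology.
Variables (R : realType) (D : smooth_space R).

(* The foliation is given by the set [P] of its leaves. A tangent vector at a
   point of a (closed, embedded) leaf is tangent to the leaf iff it annihilates
   the smooth functions that vanish on the leaf. *)
Variable P : set (set D).

Definition vertical (X : vfield D) : Prop :=
  forall L x, P L -> L x ->
  forall f : cinf D, (forall y, L y -> f y = 0) -> X f x = 0.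

Definition vertical_pred : pred (vfield D) := fun X => `[< vertical X >].

Fact vertical_submod : subsemimod_closed vertical_pred.
Proof.
split; first split.
- by apply/asboolP.
- move=> X Y /asboolP vX /asboolP vY; apply/asboolP => L x PL Lx f f0.
  rewrite -[LHS]/((X f : cinf D) x + (Y f : cinf D) x).
  by rewrite (vX _ _ PL Lx f f0) (vY _ _ PL Lx f f0) addr0.
- move=> h X /asboolP vX; apply/asboolP => L x PL Lx f f0.
  rewrite -[LHS]/(h x * (X f : cinf D) x).
  by rewrite (vX _ _ PL Lx f f0) mulr0.
Qed.

Record vert := Vert { vert_vfield :> vfield D; _ : vertical_pred vert_vfield }.
HB.instance Definition _ := [isSub for vert_vfield].
HB.instance Definition _ := [Choice of vert by <:].
HB.instance Definition _ :=
  GRing.SubChoice_isSubLmodule.Build _ _ _ vert vertical_submod.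

Lemma vertP (X : vert) : vertical X.
Proof. by case: X => X vX; apply/asboolP. Qed.

Fact bracket_vertical (X Y : vert) : vertical (bracket X Y).
Proof.
move=> L x PL Lx f f0; rewrite -[LHS]/(X (Y f) x - Y (X f) x).
rewrite (vertP X PL Lx) ?(vertP Y PL Lx) ?subrr // => y Ly.
- exact: (vertP X PL Ly).
- exact: (vertP Y PL Ly).
Qed.

Definition vbracket (X Y : vert) : vert :=
  Vert (introT (asboolP _) (bracket_vertical X Y)).

Definition cochain (p : nat) : Type := ('I_p -> vert) -> cinf D.
HB.instance Definition _ p := GRing.Lmodule.on (cochain p).

Definition set_arg p (X : 'I_p -> vert) (i : 'I_p) (Y : vert) : 'I_p -> vert :=
  fun k => if k == i then Y else X k.

Definition form p (alpha : cochain p) : Prop :=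
  (forall X i (a : cinf D) Y Z, alpha (set_arg X i (a *: Y + Z)) =
     a * alpha (set_arg X i Y) + alpha (set_arg X i Z)) /\
  (forall X i j, i != j -> X i = X j -> alpha X = 0).

(* Indices start at 0 here. The arguments of the last summand are [X_i, X_j],
   followed by the X_k with k distinct from i and j, in increasing order. *)
Definition dF p (alpha : cochain p) : cochain p.+1 := fun X =>
  \sum_(i < p.+1) (-1) ^+ i * (X i (alpha (fun k => X (lift i k))) : cinf D) +
  \sum_(i < p.+1) \sum_(j < p.+1 | (i < j)%N) (-1) ^+ (i + j) *
    alpha (fun k => if k == 0 :> nat then vbracket (X i) (X j)
                    else X (inord (bump j (bump i k.-1)))).

Definition cocycle p (alpha : cochain p) : Prop := form alpha /\ dF alpha = 0.

Definition exact_form p : cochain p -> Prop :=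
  if p is q.+1 then fun alpha => exists2 beta, form beta & alpha = @dF q beta
  else fun alpha => alpha = 0.

Lemma dF_linear p (a : R) (alpha beta : cochain p) :
  dF (a *: alpha + beta) = a *: dF alpha + dF beta.
Proof.
have ev q (u v : cochain q) Y : (a *: u + v) Y = a *: u Y + v Y by [].
apply/funext => X; rewrite ev /dF scalerDr addrACA; congr (_ + _).
  rewrite scaler_sumr -big_split; apply: eq_bigr => i _.
  by rewrite ev (vfieldP (X i)).1; exact: cinf_scaleE.
rewrite scaler_sumr -big_split; apply: eq_bigr => i _.
rewrite scaler_sumr -big_split; apply: eq_bigr => j _.
by rewrite ev; exact: cinf_scaleE.
Qed.

Lemma form_linear p (a : R) (alpha beta : cochain p) :
  form alpha -> form beta -> form (a *: alpha + beta).
Proof.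
move=> [al aa] [bl ba].
have ev Y : (a *: alpha + beta) Y = a *: alpha Y + beta Y by [].
split=> [X i f Y Z|X i j ij Xij]; rewrite !ev.
  by rewrite al bl cinf_scaleE scalerDr addrACA.
by rewrite (aa _ _ _ ij Xij) (ba _ _ _ ij Xij) scaler0 addr0.
Qed.

Lemma form0 p : form (0 : cochain p).
Proof.
have ev Y : (0 : cochain p) Y = 0 by [].
by split=> [X i f Y Z|X i j _ _]; rewrite !ev // mulr0 addr0.
Qed.

Lemma dF0 p : dF (0 : cochain p) = 0.
Proof.
by rewrite -[X in dF X](subrr 0) -scaleN1r addrC dF_linear scaleN1r addNr.
Qed.

Definition cocycle_pred p : pred (cochain p) := fun alpha => `[< cocycle alpha >].

Fact cocycle_submod p : subsemimod_closed (@cocycle_pred p).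
Proof.
have lin a (u v : cochain p) : cocycle u -> cocycle v -> cocycle (a *: u + v).
  move=> [fu du] [fv dv]; split; first exact: form_linear.
  by rewrite dF_linear du dv scaler0 addr0.
have zero : cocycle (0 : cochain p) by split; [exact: form0|exact: dF0].
split; first split.
- exact/asboolP.
- move=> u v /asboolP cu /asboolP cv; apply/asboolP.
  by rewrite -[u]scale1r; exact: lin.
- move=> a u /asboolP cu; apply/asboolP.
  by rewrite -[_ *: _]addr0; exact: lin.
Qed.

Record cocycles p :=
  Cocycle { cocycle_form :> cochain p; _ : cocycle_pred cocycle_form }.
HB.instance Definition _ p := [isSub for @cocycle_form p].
HB.instance Definition _ p := [Choice of cocycles p by <:].
HB.instance Definition _ p :=
  GRing.SubChoice_isSubLmodule.Build _ _ _ (cocycles p) (@cocycle_submod p).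

(* Since [dF] maps forms to forms and squares to zero, the cocycles among the
   exact forms are all of the exact forms. *)
Definition coboundary_pred p : pred (cocycles p) :=
  fun alpha => `[< exact_form (cocycle_form alpha) >].

Fact coboundary_submod p : submod_closed (@coboundary_pred p).
Proof.
split; first apply/asboolP.
  by case: p => [//|p]; exists 0; [exact: form0|rewrite dF0].
move=> a u v /asboolP eu /asboolP ev; apply/asboolP.
have -> : cocycle_form (a *: u + v) = a *: cocycle_form u + cocycle_form v by [].
case: p u v eu ev => [|p] u v /=.
  by move=> -> ->; rewrite scaler0 addr0.
move=> [b fb ->] [c fc ->]; exists (a *: b + c); first exact: form_linear.
by rewrite dF_linear.
Qed.
HB.instance Definition _ p := GRing.isZmodClosed.Build _ (@coboundary_pred p)
  (GRing.subsemimod_closedB (@coboundary_submod p)).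

Definition vertical_cohomology p : lmodType R :=
  mod_quot (GRing.subsemimod_closedZ (@coboundary_submod p)).

End VerticalCohomology.

(* The de Rham complex is the vertical complex of the foliation with a single
   leaf, all vector fields being tangent to it. *)
Definition one_leaf (R : realType) (D : smooth_space R) : set (set D) :=
  [set [set: D]].

Notation vect D := (vert (@one_leaf _ D)).
Notation dR_cochain D p := (cochain (@one_leaf _ D) p).

Section Geometry.
Variables (R : realType).
Implicit Types D E : smooth_space R.

Definition pairing D (omega : dR_cochain D 2) (X Y : vect D) : cinf D :=
  omega (fun k => if k == 0 :> nat then X else Y).

Definition symplectic D (omega : dR_cochain D 2) : Prop :=
  [/\ form omega, dF omega = 0 &
      forall (X : vect D) x, (forall Y, pairing omega X Y x = 0) ->
        forall f : cinf D, X f x = 0].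

(* An orientation is represented by a volume form. *)
Definition volume_form D n (Omega : dR_cochain D n) : Prop :=
  form Omega /\ forall x, exists X, Omega X x != 0.

Record diffeo D E := Diffeo {
  diffeo_fun :> D -> E;
  diffeo_inv : E -> D;
  diffeoK : cancel diffeo_fun diffeo_inv;
  diffeoVK : cancel diffeo_inv diffeo_fun;
  diffeo_continuous : continuous diffeo_fun;
  diffeo_inv_continuous : continuous diffeo_inv;
  diffeo_smooth : forall f : cinf E, smooth (f \o diffeo_fun);
  diffeo_inv_smooth : forall f : cinf D, smooth (f \o diffeo_inv)
}.

Definition pullback D E (g : diffeo D E) (f : cinf E) : cinf D :=
  mk_cinf (diffeo_smooth g f).

Definition related D E (g : diffeo D E) (X : vect D) (Y : vect E) : Prop :=
  forall f : cinf E, X (pullback g f) = pullback g (Y f).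

Definition orientation_preserving D E n (OmegaD : dR_cochain D n)
    (OmegaE : dR_cochain E n) (g : diffeo D E) : Prop :=
  forall (X : 'I_n -> vect D) (Y : 'I_n -> vect E),
    (forall i, related g (X i) (Y i)) ->
    forall x, 0 < OmegaD X x -> 0 < OmegaE Y (g x).

(* [Phi] induces a diffeomorphism from R^k / Z^k onto [T]. *)
Definition torus_param D (k : nat) (T : set D) (Phi : 'rV[R]_k -> D) : Prop :=
  [/\ continuous Phi /\ range Phi = T,
      forall f : cinf D, Cinfty_on setT (f \o Phi),
      forall p q, Phi p = Phi q <->
        exists z : 'rV[int]_k, p - q = map_mx intr z &
      forall p w, w != 0 -> exists f : cinf D, 'D_w (f \o Phi) p != 0].

Definition is_torus D (k : nat) (T : set D) : Prop :=
  exists Phi : 'rV[R]_k -> D, torus_param T Phi.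

(* The balls of ['rV[R]_n] are cubes. *)
Definition negligible_in_Rn n (N : set 'rV[R]_n) : Prop :=
  forall e : R, 0 < e -> exists (c : nat -> 'rV[R]_n) (r : nat -> R),
    [/\ forall k, 0 <= r k, N `<=` \bigcup_k ball (c k) (r k) &
        forall m, \sum_(k < m) (2 * r k) ^+ n <= e].

Definition almost_everywhere D n (A : set D) : Prop :=
  forall c : chart D n,
    negligible_in_Rn (chart_map c @` (chart_dom c `&` ~` A)).

Definition independent_at D (f g : cinf D) (x : D) : Prop :=
  forall a b : R, critical (a *: f + b *: g) x -> a = 0 /\ b = 0.

Definition hessian n (f : 'rV[R]_n -> R) (p : 'rV[R]_n) : 'M[R]_n :=
  \matrix_(i, j) 'D_(delta_mx 0 i) (fun q => 'D_(delta_mx 0 j) f q) p.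

(* Near each critical point there are coordinates (u, w) in R^k x R^m such that
   the critical points are the points with w = 0 (so that they form a
   submanifold of dimension k), and f is a nondegenerate Morse function of w at
   these points. *)
Definition bott D n (f : cinf D) : Prop :=
  forall x, critical f x -> exists k m (c : chart D (k + m)),
    [/\ (k + m)%N = n, chart_dom c x,
        forall y, chart_dom c y ->
          (critical f y <-> rsubmx (chart_map c y) = 0) &
        forall y, chart_dom c y -> critical f y ->
          drsubmx (hessian (f \o chart_inv c) (chart_map c y)) \in unitmx].

Definition leaf D (f : cinf D) (x : D) : set D :=
  connected_component [set y | f y = f x] x.

Definition liouville_foliation D (f : cinf D) : set (set D) := range (leaf f).

(* Regularity is that of the component, not of the whole level surface. *)
Definition regular_liouville_torus D (f : cinf D) (T : set D) : Prop :=
  liouville_foliation f T /\ T `&` critical f = set0.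

Definition critical_torus D (f : cinf D) (T : set D) : Prop :=
  [/\ liouville_foliation f T, T `<=` critical f & is_torus 2 T].

Definition liouville_torus D (f : cinf D) (T : set D) : Prop :=
  regular_liouville_torus f T \/ critical_torus f T.

(* The isolated critical circles: the connected components of the set of
   critical points that are circles (circles lying in a critical torus or Klein
   bottle are not among them). *)
Definition critical_circle D (f : cinf D) (S : set D) : Prop :=
  (exists2 x, critical f x & S = connected_component (critical f) x) /\
  is_torus 1 S.

Definition circles_complement D (f : cinf D) : set D :=
  ~` \bigcup_(S in critical_circle f) S.

Definition induced_foliation D (A : set D) (P : set (set D)) :
    set (set (sub_space A)) :=
  [set K | exists L (x : sub_space A), [/\ P L, L (set_val x) &
     K = connected_component ((set_val : sub_space A -> D) @^-1` L) x]].

(* The trajectories of [v] on the torus [T] are straight windings of irrational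
   slope in suitable angle coordinates. *)
Definition irrational_winding D (v : vfield D) (T : set D) : Prop :=
  exists (Phi : 'rV[R]_2 -> D) (w : 'rV[R]_2),
    [/\ torus_param T Phi,
        forall (f : cinf D) p, 'D_w (f \o Phi) p = (v f : cinf D) (Phi p) &
        forall z : 'cV[int]_2, w *m map_mx intr z = 0 -> z = 0].

End Geometry.

Arguments induced_foliation [R D] A P _.

Section Hamiltonian.
Variable R : realType.

Definition sgrad (M : smooth_space R) (omega : dR_cochain M 2) (H : cinf M)
    (v : vect M) : Prop := forall X : vect M, pairing omega X v = X H.

(* The surface {H = h} need not be connected. [iso_field] is the restriction of
   the Hamiltonian vector field to it. *)
Record isoenergetic_system := IsoenergeticSystem {
  phase_space : smooth_space R;
  phase_space_manifold : manifold phase_space 4;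
  omega : dR_cochain phase_space 2;
  omega_symplectic : symplectic omega;
  hamiltonian : cinf phase_space;
  ham_field : vect phase_space;
  ham_field_sgrad : sgrad omega hamiltonian ham_field;
  energy : R;
  energy_regular :
    forall x, hamiltonian x = energy -> ~ critical hamiltonian x;
  iso_surface := sub_space [set x | hamiltonian x = energy];
  iso_compact : compact [set: iso_surface];
  iso_orientation : dR_cochain iso_surface 3;
  iso_orientation_volume : volume_form iso_orientation;
  iso_field : vfield iso_surface;
  iso_field_restrict : forall f : cinf phase_space,
    iso_field (restrict _ f) = restrict _ (ham_field f : cinf phase_space)
}.

Arguments omega : clear implicits.
Arguments iso_orientation : clear implicits.
Implicit Type S : isoenergetic_system.

Definition iso_restrict S (f : cinf (phase_space S)) : cinf (iso_surface S) :=
  restrict _ f.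

Definition bott_integral S (f : cinf (phase_space S)) : Prop :=
  [/\ ham_field S f = 0,
      forall w, sgrad (omega S) f w -> pairing (omega S) w (ham_field S) = 0,
      almost_everywhere 4 [set x | independent_at (hamiltonian S) f x] &
      bott 3 (iso_restrict f)].

Definition nonresonant S (f : cinf (phase_space S)) : Prop :=
  dense (\bigcup_(T in [set T | regular_liouville_torus (iso_restrict f) T /\
                                irrational_winding (iso_field S) T]) T).

Definition topologically_equivalent S1 S2 (f1 : cinf (phase_space S1))
    (f2 : cinf (phase_space S2)) : Prop :=
  exists g : diffeo (iso_surface S1) (iso_surface S2),
    [/\ orientation_preserving (iso_orientation S1) (iso_orientation S2) g,
        forall T, liouville_torus (iso_restrict f1) T <->
                  liouville_torus (iso_restrict f2) (g @` T),
        forall C, critical_circle (iso_restrict f1) C <->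
                  critical_circle (iso_restrict f2) (g @` C) &
        forall C x, critical_circle (iso_restrict f1) C -> C x ->
          exists2 a : R, 0 < a &
            forall phi : cinf (iso_surface S2),
              (iso_field S1 (pullback g phi) : cinf _) x =
              a * (iso_field S2 phi : cinf _) (g x)].

(* {H = h} with the isolated critical circles of [f] removed. *)
Definition punctured_surface S (f : cinf (phase_space S)) : smooth_space R :=
  sub_space (circles_complement (iso_restrict f)).

Definition punctured_foliation S (f : cinf (phase_space S)) :
    set (set (punctured_surface f)) :=
  induced_foliation (circles_complement (iso_restrict f))
    (liouville_foliation (iso_restrict f)).

Definition iso_cohomology S (f : cinf (phase_space S)) (p : nat) : lmodType R :=
  vertical_cohomology (@punctured_foliation S f) p.

End Hamiltonian.

(* Main.v *)
Require Import Defs.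
From HB Require Import structures.
From mathcomp Require Import all_boot all_order all_algebra.
From mathcomp Require Import all_classical all_reals all_analysis.
From mathcomp Require Import ring lra.

(** The complex of vertical forms is built from the module of vertical fields on
    the punctured surface Q' and from their bracket; the leaves enter through
    that module only. A diffeomorphism that carries vertical fields to vertical
    fields in both directions therefore induces isomorphisms in cohomology, in
    every degree ([vertical_cohomology_iso]).

    A topological equivalence g matches the isolated critical circles, so it
    restricts to a diffeomorphism between the punctured surfaces ([sub_diffeo]).
    About the leaves it only says that Liouville tori correspond to Liouville
    tori. This is enough, because the tori already determine the vertical
    fields:

    - A field Y on Q' with Y f = 0 is vertical ([vertical_of_integral]): its
      integral curve through x stays on a level of f and is connected, hence
      lies in the leaf of x, so a function that vanishes on this leaf has
      derivative Y phi (x) = 0. Regular points, singular leaves and critical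
      surfaces are treated alike, without normal forms for f.
    - If X is vertical for the first system, its image kills the second integral
      on every torus without critical points, and these tori are dense by
      nonresonance ([push_vertical]).

    The rest provides the integral curves. Tangent vectors and fields are
    derivations of smooth functions; by Hadamard's lemma ([hadamard]) and bump
    functions they have coordinates in a chart of the phase space
    ([tangent_coord]). The surface Q is only known as a regular level of the
    Hamiltonian H. Instead of constructing charts of Q, the equation is solved
    in the phase space ([picard], [local_ode]) for a modified field that
    annihilates H everywhere ([tilt]), so that its solutions stay on Q; on Q it is
    the given field up to a positive factor ([field_curve]).

    The solutions must also stay in Q', which is open in Q for two reasons. The
    noncritical points form an open set ([noncritical_near], again by solving
    equations), and in Bott coordinates the critical points near a given one
    belong to the same component of the critical set ([bott_critical_near]), so
    that critical circles accumulate nowhere outside their union. *)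

Set Implicit Arguments.
Unset Strict Implicit.
Unset Printing Implicit Defensive.

Import Order.TTheory GRing.Theory Num.Theory.
Import numFieldNormedType.Exports.
Local Open Scope classical_set_scope.
Local Open Scope ring_scope.

(** * Calculus of smooth functions on open subsets of R^n *)

Section Calculus.
Variables (R : realType).

(** The differential is defined by choice, so differentiability is proved by
    exhibiting the linear approximation and identifying it afterwards. *)
Lemma is_diff_approx (V W : normedModType R) (f : V -> W) (L : {linear V -> W})
    (x : V) : continuous L ->
  (forall e : R, 0 < e ->
     \forall h \near 0, `|f (h + x) - (f x + L h)| <= e * `|h|) ->
  is_diff x f L.
Proof.
move=> cL fL.
have E : f \o shift x = cst (f x) + L +o_ 0 id by apply/eqaddoP => e /fL.
have dL : 'd f x = L :> (V -> W) by exact: diff_unique.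
split=> //; apply/diff_locallyP; rewrite dL.
by split.
Qed.

Lemma near_eq_differentiable (V W : normedModType R) (f g : V -> W) (x : V) :
  (\forall y \near x, f y = g y) -> differentiable f x -> differentiable g x.
Proof.
move=> fg df; have /diff_locallyP[cd /eqaddoP E] := df.
suff : is_diff x g ('d f x) by move=> ?; exact: ex_diff.
apply: is_diff_approx => // e e0.
have fgx : f x = g x by exact: (nbhs_singleton fg).
have fg0 : \forall h \near (0 : V), f (h + x) = g (h + x).
  by have := fg; rewrite (near_shift 0) subr0.
move: (E _ e0); near_simpl; apply: filterS2 fg0 => h /= <-.
by rewrite -fgx.
Qed.

Variable n : nat.
Implicit Types (V : set 'rV[R]_n) (f g : 'rV[R]_n -> R) (k : nat).

Definition partial (i : 'I_n) f : 'rV[R]_n -> R :=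
  fun p => 'D_(delta_mx 0 i) f p.

Lemma Ck_on_sub k V W f : V `<=` W -> Ck_on k W f -> Ck_on k V f.
Proof.
elim: k f => [|k IHk] f VW /=; first by move=> fW p /VW; exact: fW.
by move=> [df Df]; split=> [p /VW|i]; [exact: df|exact: IHk].
Qed.

Lemma Ck_on_setU k V W f : Ck_on k V f -> Ck_on k W f -> Ck_on k (V `|` W) f.
Proof.
elim: k f => [|k IHk] f /=; first by move=> fV fW p []; [exact: fV|exact: fW].
move=> [dV DV] [dW DW]; split=> [p []|i]; [exact: dV|exact: dW|].
exact: IHk.
Qed.

Lemma Ck_on_ext k V f g : open V -> (forall p, V p -> f p = g p) ->
  Ck_on k V f -> Ck_on k V g.
Proof.
move=> oV; elim: k f g => [|k IHk] f g fg /=.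
  move=> fc p Vp; have near_fg : \forall q \near p, f q = g q.
    by apply: filterS (open_nbhs_nbhs (conj oV Vp)) => q; exact: fg.
  rewrite /prop_for /continuous_at -(fg p Vp).
  exact: cvg_trans (near_eq_cvg near_fg) (fc p Vp).
have near_fg p : V p -> \forall q \near p, f q = g q.
  by move=> Vp; apply: filterS (open_nbhs_nbhs (conj oV Vp)) => q; exact: fg.
move=> [df Df]; split=> [p Vp|i].
  by apply: near_eq_differentiable (near_fg p Vp) (df p Vp).
by apply: IHk (Df i) => p Vp; exact: near_eq_derive _ (near_fg p Vp).
Qed.

Lemma Ck_onW k V f : Ck_on k.+1 V f -> Ck_on k V f.
Proof.
elim: k f => [|k IHk] f /=.
  by move=> [df _] p Vp; exact: differentiable_continuous (df p Vp).
by move=> [df Df]; split=> // i; apply: IHk; exact: Df.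
Qed.

Lemma Ck_on_cst k V (a : R) : Ck_on k V (cst a).
Proof.
elim: k a => [|k IHk] a /=; first by move=> p _; exact: cst_continuous.
split=> [p _|i]; first exact: differentiable_cst.
have -> : (fun p => 'D_(delta_mx 0 i) (cst a) p) = cst 0 :> ('rV[R]_n -> R).
  by apply/funext => p; exact: derive_cst.
exact: IHk.
Qed.

Lemma Ck_onD k V f g : open V -> Ck_on k V f -> Ck_on k V g ->
  Ck_on k V (f + g).
Proof.
move=> oV; elim: k f g => [|k IHk] f g /=.
  by move=> cf cg p Vp; apply: continuousD; [exact: cf|exact: cg].
move=> [df Df] [dg Dg]; split=> [p Vp|i].
  by apply: differentiableD; [exact: df|exact: dg].
apply: Ck_on_ext oV _ (IHk _ _ (Df i) (Dg i)) => p Vp.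
rewrite deriveD //; first exact/diff_derivable/df.
exact/diff_derivable/dg.
Qed.

Lemma Ck_onM k V f g : open V -> Ck_on k V f -> Ck_on k V g ->
  Ck_on k V (f * g).
Proof.
move=> oV; elim: k f g => [|k IHk] f g.
  by move=> /= cf cg p Vp; apply: continuousM; [exact: cf|exact: cg].
move=> Cf Cg; have [[df Df] [dg Dg]] := (Cf, Cg); split=> [p Vp|i].
  by apply: differentiableM; [exact: df|exact: dg].
have H1 := IHk _ _ (Ck_onW Cf) (Dg i); have H2 := IHk _ _ (Ck_onW Cg) (Df i).
apply: Ck_on_ext oV _ (Ck_onD oV H1 H2) => p Vp.
by rewrite deriveM //; [exact/diff_derivable/df|exact/diff_derivable/dg].
Qed.

Lemma derive_coord (v p : 'rV[R]_n) (j : 'I_n) :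
  'D_v (fun q : 'rV[R]_n => q 0 j) p = v 0 j.
Proof.
have d : derivable (id : 'rV[R]_n -> 'rV[R]_n) p v by exact: derivable_id.
have := derive_mx d; rewrite derive_id => /(congr1 (fun A : 'rV[R]_n => A 0 j)).
by rewrite mxE => <-.
Qed.

Lemma Ck_on_coord k V (j : 'I_n) : Ck_on k V (fun p => p 0 j).
Proof.
apply: Ck_onW => /=; split=> [p _|i]; first exact: differentiable_coord.
have -> : (fun p => 'D_(delta_mx 0 i) (fun q : 'rV[R]_n => q 0 j) p) =
    cst ((delta_mx 0 i : 'rV[R]_n) 0 j) :> ('rV[R]_n -> R).
  by apply/funext => p; exact: derive_coord.
exact: Ck_on_cst.
Qed.

Lemma derive_partial f p (w : 'rV[R]_n) : differentiable f p ->
  'D_w f p = \sum_i w 0 i * partial i f p.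
Proof.
move=> df; rewrite deriveE // {1}[w]row_sum_delta linear_sum.
by apply: eq_bigr => i _; rewrite linearZ /partial deriveE.
Qed.

Lemma is_derive_curve f (c : R -> 'rV[R]_n) (t : R) (w : 'rV[R]_n) :
  differentiable f (c t) -> is_derive t 1 c w ->
  is_derive t 1 (f \o c) (\sum_i w 0 i * partial i f (c t)).
Proof.
move=> df [dc <-]; have dc' : differentiable c t by exact/derivable1_diffP.
rewrite -derive_partial //; split.
  by apply/derivable1_diffP; exact: differentiable_comp.
rewrite deriveE; last exact: differentiable_comp.
by rewrite diff_comp //= deriveE // deriveE.
Qed.

Lemma is_derive_rowP (c : R -> 'rV[R]_n) (t : R) (w : 'rV[R]_n) :
  (forall i, is_derive t 1 (fun s => c s 0 i) (w 0 i)) -> is_derive t 1 c w.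
Proof.
move=> dc; have dc' : derivable c t 1.
  by apply/derivable_mxP => i j; rewrite ord1; have [] := dc j.
split=> //; rewrite derive_mx //; apply/rowP => j; rewrite mxE.
by have [] := dc j.
Qed.

(** All the derivatives of the outer function are given at once, as the sequence
    [D], so that the induction on the order runs over every [D j] simultaneously. *)
Lemma Ck_on_comp k V (q : 'rV[R]_n -> R) (D : nat -> R -> R) : open V ->
  Cinfty_on V q ->
  (forall (j : nat) (t : R), is_derive t (1 : R) (D j) (D j.+1 t)) ->
  forall j, Ck_on k V (D j \o q).
Proof.
move=> oV Cq dD.
have D1 j t : differentiable (D j) t.
  by apply/derivable1_diffP; have [] := dD j t.
elim: k => [|k IHk] j /=.
  move=> p Vp; apply: continuous_comp; first exact: (Cq 0%N).
  exact: differentiable_continuous.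
have [dq Dq] := Cq k.+1.
split=> [p Vp|i]; first by apply: differentiable_comp; [exact: dq|exact: D1].
apply: Ck_on_ext oV _ (Ck_onM oV (IHk j.+1) (Dq i)) => p Vp /=.
rewrite deriveE; last by apply: differentiable_comp; [exact: dq|exact: D1].
rewrite diff_comp //=; last exact: dq.
rewrite diff1E // -deriveE; last exact: dq.
rewrite derive1E; have [_ ->] := dD j (q p).
by rewrite [LHS]mulrC.
Qed.

End Calculus.

Section Cinfty.
Variables (R : realType) (n : nat) (V : set 'rV[R]_n).
Hypothesis oV : open V.
Implicit Types f g : 'rV[R]_n -> R.

Lemma Cinfty_on_ext f g : (forall p, V p -> f p = g p) ->
  Cinfty_on V f -> Cinfty_on V g.
Proof. by move=> fg Cf k; apply: Ck_on_ext oV fg (Cf k). Qed.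

Lemma Cinfty_onD f g : Cinfty_on V f -> Cinfty_on V g -> Cinfty_on V (f + g).
Proof. by move=> Cf Cg k; exact: Ck_onD. Qed.

Lemma Cinfty_onM f g : Cinfty_on V f -> Cinfty_on V g -> Cinfty_on V (f * g).
Proof. by move=> Cf Cg k; exact: Ck_onM. Qed.

Lemma Cinfty_on_cst a : Cinfty_on V (cst a).
Proof. by move=> k; exact: Ck_on_cst. Qed.

Lemma Cinfty_on_coord j : Cinfty_on V (fun p => p 0 j).
Proof. by move=> k; exact: Ck_on_coord. Qed.

Lemma Cinfty_onN f : Cinfty_on V f -> Cinfty_on V (- f).
Proof.
move=> Cf; apply: Cinfty_on_ext (Cinfty_onM (Cinfty_on_cst (-1)) Cf) => p _.
exact: mulN1r.
Qed.

Lemma Cinfty_on_sum (I : Type) (r : seq I) (F : I -> 'rV[R]_n -> R) :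
  (forall i, Cinfty_on V (F i)) -> Cinfty_on V (fun p => \sum_(i <- r) F i p).
Proof.
move=> CF; elim: r => [|i r IHr].
  by apply: Cinfty_on_ext (Cinfty_on_cst 0) => p _; rewrite big_nil.
by apply: Cinfty_on_ext (Cinfty_onD (CF i) IHr) => p _; rewrite big_cons.
Qed.

Lemma Cinfty_on_partial f i : Cinfty_on V f -> Cinfty_on V (partial i f).
Proof. by move=> Cf k; have [_] := Cf k.+1; exact. Qed.

Lemma Cinfty_on_differentiable f p : Cinfty_on V f -> V p -> differentiable f p.
Proof. by move=> Cf; have [+ _] := Cf 1%N; exact. Qed.

Lemma Cinfty_on_continuous f p : Cinfty_on V f -> V p -> {for p, continuous f}.
Proof. by move=> Cf; exact: (Cf 0%N). Qed.

End Cinfty.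

(** * Bump functions on R^n *)

Section Bump.
Variable R : realType.
Implicit Types P Q : {poly R}.

(** The factor [X] costs half of the exponent, since s <= (2/a) exp(a s / 2); the
    rate [a] is therefore arbitrary in the induction. *)
Lemma poly_le_expR Q (a : R) : 0 < a ->
  exists2 C : R, 0 <= C & forall s : R, 0 < s -> `|Q.[s]| <= C * expR (a * s).
Proof.
elim/poly_ind: Q a => [|Q c IHQ] a a0.
  by exists 0 => // s s0; rewrite horner0 normr0 mul0r.
have a20 : 0 < a / 2 by rewrite divr_gt0.
have [C C0 HC] := IHQ (a / 2) a20.
have Ca : 0 <= C / (a / 2) by rewrite divr_ge0 // ltW.
exists (C / (a / 2) + `|c|); first exact: addr_ge0.
move=> s s0; rewrite hornerMXaddC; apply: le_trans (ler_normD _ _) _.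
rewrite mulrDl; apply: lerD; last first.
  rewrite -[leLHS]mulr1; apply: ler_wpM2l => //.
  by rewrite -expR0 ler_expR mulr_ge0 // ltW.
rewrite normrM (gtr0_norm s0).
have -> : expR (a * s) = expR (a / 2 * s) * expR (a / 2 * s).
  by rewrite -expRD -mulrDl -splitr.
have sE : s <= (a / 2)^-1 * expR (a / 2 * s).
  rewrite ler_pdivlMl //; apply: le_trans (expR_ge1Dx _).
  by rewrite lerDr ler01.
apply: le_trans (ler_pM _ (ltW s0) (HC s s0) sE) _ => //.
by rewrite le_eqVlt; apply/orP; left; apply/eqP; ring.
Qed.

(** The functions P(1/t) exp(-1/t), extended by 0, are closed under derivation
    ([is_derive_flat]), which makes each of them smooth. *)
Definition flat P (t : R) : R :=
  if 0 < t then P.[t^-1] * expR (- t^-1) else 0.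

(** The quadratic bound gives derivative 0 at the origin; it comes from the
    exponential growth bound applied to s^2 P(s) with s = 1/t. *)
Lemma flat_le P : exists2 C : R, 0 <= C & forall t, `|flat P t| <= C * t ^+ 2.
Proof.
have [C C0 HC] := poly_le_expR ('X^2 * P) ltr01.
exists C => // t; rewrite /flat; case: ifPn => [t0|_]; last first.
  by rewrite normr0 mulr_ge0 // sqr_ge0.
have t10 : 0 < t^-1 by rewrite invr_gt0.
have := HC _ t10; rewrite hornerM hornerXn normrM normrX (gtr0_norm t10) mul1r.
rewrite exprVn.
rewrite ler_pdivrMl ?exprn_gt0 // => H.
by rewrite normrM (gtr0_norm (expR_gt0 _)) expRN ler_pdivrMr ?expR_gt0 // mulrAC mulrC.
Qed.

Lemma is_derive_flat P (t : R) :
  is_derive t (1 : R) (flat P) (flat ('X^2 * (P - P^`())) t).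
Proof.
case: (ltgtP t 0) => [t0|t0|->].
- rewrite {2}/flat ltNge (ltW t0) /=.
  apply: near_eq_is_derive (is_derive_cst 0 t 1).
  near=> s; rewrite /flat ifF //; apply/negbTE; rewrite -leNgt ltW //.
  by near: s; exact: lt_nbhsl.
- have tn0 : t != 0 by rewrite gt_eqF.
  rewrite {2}/flat t0.
  have dV : is_derive t (1 : R) (fun s : R => s^-1) (- t ^- 2).
    by apply: is_derive_eq; [exact: is_deriveV|rewrite scaler1].
  have dP := @is_derive1_comp _ (horner P) _ t _ _ (is_derive_poly P t^-1) dV.
  have dE := @is_derive1_comp _ expR _ t _ _ (is_derive_expR (- t^-1))
    (is_deriveN dV).
  have H := is_deriveM dP dE.
  apply: near_eq_is_derive (is_derive_eq H _).
    near=> s; rewrite /flat ifT //; near: s; exact: lt_nbhsr.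
  rewrite /= hornerM hornerD hornerN hornerXn /GRing.scale /=.
  rewrite exprVn; ring.
- have [C C0 HC] := flat_le P.
  have F0 Q : flat Q 0 = 0 by rewrite /flat ltxx.
  have cv : (fun h : R => h^-1 *: ((flat P \o shift 0) (h *: 1) - flat P 0)) h
      @[h --> 0^'] --> (0 : R).
    have C1 : 0 < C + 1 by rewrite ltr_wpDl.
    apply/cvgrPdist_le => e e0; near=> h.
    have h0 : h != 0 by near: h; exact: nbhs_dnbhs_neq.
    have nh : 0 < `|h| by rewrite normr_gt0.
    rewrite /= F0 subr0 addr0 sub0r normrN /GRing.scale /= mulr1 normrM normfV.
    rewrite ler_pdivrMl //; apply: le_trans (HC h) _.
    rewrite -real_normK ?num_real // expr2 mulrCA [_ * e]mulrC.
    rewrite [leRHS]mulrC; apply: ler_wpM2l; first exact: ltW.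
    have hC : `|h| <= e / (C + 1).
      by near: h; apply: dnbhs0_le; rewrite divr_gt0.
    move: hC; rewrite ler_pdivlMr // => hC.
    by apply: le_trans hC; rewrite mulrC ler_wpM2l // lerDl.
  rewrite F0; split; first by apply/cvg_ex; exists 0.
  exact: cvg_lim cv.
Unshelve. all: by end_near. Qed.

Lemma flat1_gt0 (t : R) : 0 < t -> 0 < flat 1 t.
Proof. by move=> t0; rewrite /flat t0 hornerE mul1r expR_gt0. Qed.

Lemma flat_le0 P (t : R) : t <= 0 -> flat P t = 0.
Proof. by rewrite /flat ltNge => ->. Qed.

(** The square of the Euclidean norm is used because it is a polynomial; the
    support lies in the cube of the same radius, which is the ball of the norm
    of the space of row vectors. *)
Definition ball_bump n (p : 'rV[R]_n) (r : R) (z : 'rV[R]_n) : R :=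
  flat 1 (r ^+ 2 - \sum_i (z 0 i - p 0 i) ^+ 2).

Lemma Cinfty_on_ball_bump n (p : 'rV[R]_n) r V : open V ->
  Cinfty_on V (ball_bump p r).
Proof.
move=> oV k.
pose D j := flat (iter j (fun P => 'X^2 * (P - P^`())) 1).
have dD (j : nat) (t : R) : is_derive t (1 : R) (D j) (D j.+1 t).
  exact: is_derive_flat.
apply: (Ck_on_comp k oV _ dD 0%N); apply: Cinfty_onD => //.
  exact: Cinfty_on_cst.
apply: Cinfty_onN => //; apply: Cinfty_on_sum => // i.
have H : Cinfty_on V (fun z => z 0 i - p 0 i).
  apply: (Cinfty_onD oV); first exact: Cinfty_on_coord.
  exact: (Cinfty_on_cst _ (- p 0 i)).
exact: (Cinfty_onM oV H H).
Qed.

Lemma ball_bump_center n (p : 'rV[R]_n) r : 0 < r -> 0 < ball_bump p r p.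
Proof.
move=> r0; apply: flat1_gt0; rewrite big1 ?subr0 ?exprn_gt0 // => i _.
by rewrite subrr expr0n.
Qed.

Lemma ball_bump_out n (p z : 'rV[R]_n) r : 0 < r -> ~ `|z - p| < r ->
  ball_bump p r z = 0.
Proof.
move=> r0 /negP; rewrite -leNgt => zp; apply: flat_le0; rewrite subr_le0.
suff [i ri] : exists i, r <= `|z 0 i - p 0 i|.
  rewrite (bigD1 i) //= -[leLHS]addr0; apply: lerD.
    by rewrite -[leRHS]real_normK ?num_real // lerXn2r // nnegrE ltW.
  by apply: sumr_ge0 => j _; exact: sqr_ge0.
have [zp0|/mx_norm_neq0 [[i j] E]] := eqVneq `|z - p| 0.
  by move: zp; rewrite zp0 leNgt r0.
exists j; move: zp; rewrite [`|z - p|]E /= ord1 !mxE.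
by [].
Qed.
End Bump.

(** * Antiderivatives and mean value bounds *)

Section Antiderivative.
Variable R : realType.

(** All the integrals below are taken as values of antiderivatives, which are
    then compared by the mean value theorem ([derive_bound]). *)
Lemma antiderivative (c : R -> R) (b : R) : continuous c ->
  exists2 P : R -> R, P 0 = 0 &
    forall t, `|t| < b -> is_derive t (1 : R) P (c t).
Proof.
move=> cc.
pose I x := \int[lebesgue_measure]_(t in [set` Interval (BLeft (- b)) (BRight x)]) c t.
exists (fun x => I x - I 0); first by rewrite subrr.
move=> t; rewrite ltr_norml => /andP[bt tb].
have [dI DI] : derivable (I : R -> R) t 1 /\ I^`()%classic t = c t.
  apply: (@continuous_FTC1 _ c (BLeft (- b)) t b tb).
  - apply: continuous_compact_integrable; first exact: segment_compact.
    exact: continuous_subspaceT.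
  - by rewrite lte_fin.
  - exact: cc.
have dI' : is_derive t (1 : R) I (c t) by split=> //; rewrite -derive1E.
apply: is_derive_eq (subr0 _); exact: is_deriveB.
Qed.

Lemma derive_bound (P c : R -> R) (d M : R) :
  (forall t, `|t| < d -> is_derive t (1 : R) P (c t)) ->
  (forall t, `|t| < d -> `|c t| <= M) ->
  forall s t, `|s| < d -> `|t| < d -> `|P t - P s| <= M * `|t - s|.
Proof.
move=> dP cM.
suff H s t : s <= t -> `|s| < d -> `|t| < d -> `|P t - P s| <= M * `|t - s|.
  move=> s t sd td; have [st|/ltW ts] := leP s t; first exact: H.
  by rewrite distrC [X in _ * X]distrC; exact: H.
move=> st; rewrite !ltr_norml => /andP[s1 s2] /andP[t1 t2].
have I u : u \in `[s, t] -> `|u| < d.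
  by rewrite in_itv/= ltr_norml => /andP[? ?]; apply/andP; split; lra.
have [||u /I ud ->] := @MVT_segment _ P c s t st.
- move=> u ust; apply: dP; apply: I; exact: subset_itv_oo_cc ust.
- apply: derivable_within_continuous => u /I ud.
  by have [] := dP u ud.
- by rewrite normrM ler_wpM2r // cM //.
Qed.

Variable n : nat.

Lemma antiderivative_row (c : R -> 'rV[R]_n) (b : R) : continuous c ->
  exists2 P : R -> 'rV[R]_n, P 0 = 0 &
    forall t, `|t| < b -> is_derive t (1 : R) P (c t).
Proof.
move=> cc.
have /choice[P HP] : forall i : 'I_n, exists P : R -> R, P 0 = 0 /\
    forall t, `|t| < b -> is_derive t (1 : R) P (c t 0 i).
  move=> i; have [|P P0 dP] := @antiderivative (fun t => c t 0 i) b.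
    move=> t; apply: (@continuous_comp _ _ _ c (fun z : 'rV[R]_n => z 0 i)).
      exact: cc.
    exact: coord_continuous.
  by exists P.
exists (fun t => \row_i P i t); first by apply/rowP => i; rewrite !mxE (HP i).1.
move=> t tb; apply: is_derive_rowP => i.
have -> : (fun s : R => (\row_j P j s) 0 i) = P i by apply/funext => s; rewrite mxE.
exact: (HP i).2.
Qed.

Lemma row_norm_le (z : 'rV[R]_n) (M : R) : 0 <= M ->
  (forall i, `|z 0 i| <= M) -> `|z| <= M.
Proof.
move=> M0 zM; have [->//|/mx_norm_neq0 [[i j] E]] := eqVneq `|z| 0.
by rewrite [`|z|]E ord1 /=.
Qed.

Lemma row_norm_coord (z : 'rV[R]_n) i : `|z 0 i| <= `|z|.
Proof.
rewrite [leRHS]/Num.Def.normr /= mx_normrE; apply/bigmax_geP; right => /=.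
by exists (0, i).
Qed.

Lemma derive_coord_curve (P : R -> 'rV[R]_n) (t : R) w i :
  is_derive t (1 : R) P w -> is_derive t (1 : R) (fun s => P s 0 i) (w 0 i).
Proof.
move=> [dP <-]; split; first by move/derivable_mxP : dP; exact.
by rewrite derive_mx // mxE.
Qed.

Lemma derive_bound_row (P c : R -> 'rV[R]_n) (d M : R) : 0 <= M ->
  (forall t, `|t| < d -> is_derive t (1 : R) P (c t)) ->
  (forall t, `|t| < d -> `|c t| <= M) ->
  forall s t, `|s| < d -> `|t| < d -> `|P t - P s| <= M * `|t - s|.
Proof.
move=> M0 dP cM s t sd td; apply: row_norm_le; first exact: mulr_ge0.
move=> i; rewrite !mxE.
apply: (@derive_bound (fun u => P u 0 i) (fun u => c u 0 i) d) => // u ud.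
  exact/derive_coord_curve/dP.
exact: le_trans (row_norm_coord _ i) (cM u ud).
Qed.

End Antiderivative.

(** * Existence of solutions of Lipschitz differential equations *)

Section Picard.
Variable R : realType.

(** Composing with this retraction turns a map known on an interval only into
    one that is defined, continuous or Lipschitz on the whole line. *)
Definition clamp (d t : R) : R := Num.max (- d) (Num.min d t).

Lemma clamp_le d t : 0 <= d -> `|clamp d t| <= d.
Proof.
move=> d0; rewrite /clamp ler_norml /Num.max /Num.min.
by case: (ltP d t) => ?; case: ltP => ?; apply/andP; split; lra.
Qed.

Lemma clamp_id d t : `|t| <= d -> clamp d t = t.
Proof.
by rewrite ler_norml /clamp => /andP[t1 t2]; rewrite (min_idPr t2) (max_idPr t1).
Qed.

Lemma clamp_lipschitz d s t : `|clamp d t - clamp d s| <= `|t - s|.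
Proof.
rewrite /clamp ler_norml /Num.max /Num.min.
have [st|/ltW ts] := leP s t.
  rewrite (ger0_norm (_ : 0 <= t - s)) ?subr_ge0 //.
  by case: (ltP d t) => ?; case: (ltP d s) => ?; case: ltP => ?; case: ltP => ?;
    apply/andP; split; lra.
rewrite (ler0_norm (_ : t - s <= 0)) ?subr_le0 //.
by case: (ltP d t) => ?; case: (ltP d s) => ?; case: ltP => ?; case: ltP => ?;
  apply/andP; split; lra.
Qed.

Lemma lipschitz_continuous (V W : normedModType R) (f : V -> W) (L : R) :
  (forall x y, `|f y - f x| <= L * `|y - x|) -> continuous f.
Proof.
move=> fL x; apply/cvgrPdist_le => e e0.
have L1 : 0 < `|L| + 1 by rewrite ltr_wpDl.
have c0 : 0 < (`|L| + 1)^-1 * e by rewrite mulr_gt0 // invr_gt0.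
have N : \forall y \near x, `|x - y| <= (`|L| + 1)^-1 * e.
  exact: (cvgr_dist_le id x (@cvg_id _ (nbhs x)) _ c0).
apply: filterS N => y; rewrite ler_pdivlMl // distrC [`|f x - _|]distrC.
apply: le_trans; apply: le_trans (fL x y) _; apply: ler_wpM2r => //.
by apply: le_trans (ler_norm _) _; rewrite lerDl.
Qed.

Lemma clamp_continuous (d : R) : continuous (clamp d).
Proof.
by apply: (@lipschitz_continuous _ _ _ 1) => x y; rewrite mul1r clamp_lipschitz.
Qed.

(** The limit is the supremum of the lower bounds u_k - 2 M 2^-k. *)
Lemma geometric_cvg (u : nat -> R) (M : R) : 0 <= M ->
  (forall k, `|u k.+1 - u k| <= M * 2^-1 ^+ k) ->
  exists l, forall k, `|u k - l| <= 2 * M * 2^-1 ^+ k.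
Proof.
move=> M0 uM; pose e k : R := 2 * M * 2^-1 ^+ k.
have eS k : e k = M * 2^-1 ^+ k + e k.+1 by rewrite /e exprS; field.
have e0 k : 0 <= e k by rewrite !mulr_ge0.
have lo : {homo (fun k => u k - e k) : k m / (k <= m)%N >-> k <= m}.
  apply: homo_leq => [x //|x y z|k]; first exact: le_trans.
  by have := uM k; have := eS k; rewrite ler_norml => -> /andP[? ?]; lra.
have hi : {homo (fun k => u k + e k) : k m / (k <= m)%N >-> m <= k}.
  apply: homo_leq => [x //|x y z xy yz|k]; first exact: le_trans yz xy.
  by have := uM k; have := eS k; rewrite ler_norml => -> /andP[? ?]; lra.
have lohi k m : u k - e k <= u m + e m.
  have A := lo _ _ (leq_maxl k m); have B := hi _ _ (leq_maxr k m).
  by have := e0 (maxn k m); lra.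
pose A := range (fun k => u k - e k).
have supA : has_sup A.
  split; first by exists (u 0%N - e 0%N), 0%N.
  by exists (u 0%N + e 0%N) => _ [k _ <-]; exact: lohi.
exists (sup A) => k; rewrite -/(e k).
have l1 : u k - e k <= sup A by apply: ub_le_sup; [exact: supA.2|exists k].
have l2 : sup A <= u k + e k by apply: ge_sup; [exact: supA.1|move=> _ [m _ <-]].
by rewrite ler_norml; apply/andP; split; lra.
Qed.

Lemma half_exp_small (C x : R) : (forall k, x <= C * 2^-1 ^+ k) -> x <= 0.
Proof.
move=> H; rewrite leNgt; apply/negP => x0.
set k := (Num.truncn (C / x)).+1.
have Ck : C < x * 2 ^+ k.
  rewrite mulrC -ltr_pdivrMr //; apply: lt_le_trans (truncnS_gt _) _.
  by rewrite -natrX ler_nat ltnW // ltn_expl.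
have := H k; rewrite exprVn ler_pdivlMr ?exprn_gt0 //.
by rewrite leNgt Ck.
Qed.

Lemma near_norm_lt (V : normedModType R) (t : V) (d : R) : `|t| < d ->
  \forall s \near t, `|s| < d.
Proof. exact: (cvgr_norm_lt (f := id) t (@cvg_id _ (nbhs t))). Qed.

(** The Picard iterates differ by at most B d 2^-k on |t| < d because L d <= 1/2.
    The limit is shown to solve the equation by comparing it with an
    antiderivative of its own right-hand side. *)
Lemma picard n (F : 'rV[R]_n -> 'rV[R]_n) (L B : R) (p : 'rV[R]_n) : 0 <= L ->
  (forall z w, `|F w - F z| <= L * `|w - z|) -> (forall z, `|F z| <= B) ->
  exists2 d : R, 0 < d & exists2 g : R -> 'rV[R]_n, g 0 = p &
    forall t, `|t| < d -> is_derive t (1 : R) g (F (g t)).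
Proof.
move=> L0 FL FB; have cF : continuous F by exact: lipschitz_continuous FL.
have B0 : 0 <= B by exact: le_trans (FB 0).
pose d := (2 * (L + 1))^-1.
have d0 : 0 < d by rewrite invr_gt0 mulr_gt0 // ltr_wpDl.
have Ld : L * d <= 2^-1.
  rewrite /d invfM mulrCA -[leRHS]mulr1; apply: ler_wpM2l => //.
  by rewrite ler_pdivrMr ?ltr_wpDl // mul1r lerDl.
have step (g : R -> 'rV[R]_n) : continuous g ->
    exists g', [/\ continuous g', g' 0 = p &
      forall t, `|t| < d -> is_derive t (1 : R) g' (F (g t))].
  move=> cg; have [|P P0 dP] := @antiderivative_row _ _ (F \o g) (2 * d).
    by move=> t; apply: continuous_comp; [exact: cg|exact: cF].
  (* The clamp keeps the new iterate continuous outside |t| < d. *)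
  exists (fun t => p + P (clamp d t)); split.
  - move=> t; apply: continuousD; first exact: cst_continuous.
    apply: (@continuous_comp _ _ _ (clamp d) P); first exact: clamp_continuous.
    apply: differentiable_continuous; apply/derivable1_diffP.
    have [|//] := dP (clamp d t).
    by apply: le_lt_trans (clamp_le _ (ltW d0)) _; lra.
  - by rewrite clamp_id ?normr0 ?ltW // P0 addr0.
  - move=> t td.
    have dP' : is_derive t (1 : R) (fun s => p + P s) (F (g t)).
      have H : is_derive t (1 : R) P (F (g t)) by apply: dP; lra.
      rewrite -[F (g t)]add0r.
      exact: (is_deriveD (is_derive_cst p t (1 : R)) H).
    apply: near_eq_is_derive dP'.
    by apply: filterS (near_norm_lt td) => s sd; rewrite clamp_id // ltW.
pose next g := if pselect (continuous g) is left cg then sval (cid (step g cg))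
               else g.
have nextP g : continuous g -> [/\ continuous (next g), next g 0 = p &
      forall t, `|t| < d -> is_derive t (1 : R) (next g) (F (g t))].
  by move=> cg; rewrite /next; case: pselect => // cg'; case: cid.
pose g_ k := iter k next (cst p).
have cg k : continuous (g_ k).
  elim: k => [|k IHk]; first exact: cst_continuous.
  by have [] := nextP _ IHk.
have g0 k : g_ k 0 = p.
  by case: k => [//|k]; have [] := nextP _ (cg k).
have dg k t : `|t| < d -> is_derive t (1 : R) (g_ k.+1) (F (g_ k t)).
  by have [_ _] := nextP _ (cg k); exact.
have z0 : `|0 : R| < d by rewrite normr0.
have M0 : 0 <= B * d by rewrite mulr_ge0 // ltW.
have contr k (t : R) : `|t| < d -> `|g_ k.+1 t - g_ k t| <= B * d * 2^-1 ^+ k.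
  elim: k t => [|k IHk] t td.
    rewrite expr0 mulr1 -[g_ 0%N t]/p -(g0 1%N).
    apply: le_trans (derive_bound_row B0 (dg 0%N) _ z0 td) _ => //.
    by rewrite subr0 ler_wpM2l // ltW.
  have C0 : 0 <= L * (B * d * 2^-1 ^+ k) by rewrite !mulr_ge0 // ltW.
  have D s : `|s| < d -> is_derive s (1 : R) (g_ k.+2 - g_ k.+1)
      (F (g_ k.+1 s) - F (g_ k s)).
    by move=> sd; have ? := dg k.+1 s sd; have ? := dg k s sd; exact: is_deriveB.
  have := derive_bound_row C0 D _ z0 td.
  rewrite -[(_ - _) t]/(g_ k.+2 t - g_ k.+1 t).
  rewrite -[(_ - _) 0]/(g_ k.+2 0 - g_ k.+1 0) !g0 subrr !subr0 => H.
  apply: le_trans (H _) _ => [s sd|].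
    by apply: le_trans (FL _ _) _; apply: ler_wpM2l => //; exact: IHk.
  apply: (@le_trans _ _ (L * (B * d * 2^-1 ^+ k) * d)).
    by apply: ler_wpM2l => //; exact: ltW.
  rewrite (_ : _ * d = (B * d * 2^-1 ^+ k) * (L * d)); last by ring.
  rewrite exprSr [leRHS]mulrA; apply: ler_wpM2l => //; exact: mulr_ge0.
have e0 k : 0 <= 2 * (B * d) * 2^-1 ^+ k by rewrite mulr_ge0 // mulr_ge0.
have /choice[g gP] : forall t : R, exists l : 'rV[R]_n, `|t| < d -> forall k,
    `|g_ k t - l| <= 2 * (B * d) * 2^-1 ^+ k.
  move=> t.
  have [td|] := pselect (`|t| < d); last by exists 0.
  have /choice[l lP] : forall i, exists l, forall k,
      `|g_ k t 0 i - l| <= 2 * (B * d) * 2^-1 ^+ k.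
    move=> i; apply: geometric_cvg => // k; apply: le_trans _ (contr k t td).
    by have := row_norm_coord (g_ k.+1 t - g_ k t) i; rewrite !mxE.
  exists (\row_i l i) => _ k; apply: row_norm_le; first exact: e0.
  by move=> i; rewrite !mxE.
have gL (s t : R) : `|s| < d -> `|t| < d -> `|g t - g s| <= B * `|t - s|.
  move=> sd td; rewrite -subr_le0.
  apply: (@half_exp_small (4 * (B * d))) => k.
  have E := derive_bound_row B0 (dg k) (fun s _ => FB _) sd td.
  have G1 := gP t td k.+1; have G2 := gP s sd k.+1.
  have : `|g t - g s| <= `|g_ k.+1 t - g t| + `|g_ k.+1 t - g_ k.+1 s| +
      `|g_ k.+1 s - g s|.
    rewrite (_ : g t - g s = - (g_ k.+1 t - g t) + (g_ k.+1 t - g_ k.+1 s) +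
      (g_ k.+1 s - g s)); last by rewrite opprB !subrKA.
    by do 2 (apply: le_trans (ler_normD _ _) _; rewrite lerD2r); rewrite normrN.
  have : 2 * (B * d) * 2^-1 ^+ k.+1 + 2 * (B * d) * 2^-1 ^+ k.+1
    <= 4 * (B * d) * 2^-1 ^+ k.
    have := (exprn_ge0 k (_ : 0 <= 2^-1 :> R)); rewrite exprS; nra.
  lra.
have d20 : 0 < d / 2 by rewrite divr_gt0.
have d2d (t : R) : `|t| <= d / 2 -> `|t| < d by move=> ?; lra.
have [|P P0 dP] := @antiderivative_row _ _ (F \o g \o clamp (d / 2)) (d / 2).
  move=> t; apply: (@continuous_comp _ _ _ (g \o clamp (d / 2)) F); last exact: cF.
  move: t; apply: (@lipschitz_continuous _ _ _ B) => s t.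
  apply: le_trans (gL _ _ _ _) _; try exact/d2d/clamp_le/ltW.
  by apply: ler_wpM2l => //; exact: clamp_lipschitz.
have dP' (t : R) : `|t| < d / 2 -> is_derive t (1 : R) P (F (g t)).
  by move=> td; have := dP t td; rewrite /= clamp_id // ltW.
have gE (t : R) : `|t| < d / 2 -> g t = p + P t.
  move=> td; apply/eqP; rewrite -subr_eq0 -normr_le0.
  apply: (@half_exp_small (2 * (B * d) + L * (2 * (B * d)) * d)) => k.
  have td' := d2d t (ltW td).
  have z02 : `|0 : R| < d / 2 by rewrite normr0.
  have C0 : 0 <= L * (2 * (B * d) * 2^-1 ^+ k) by exact: mulr_ge0.
  have D s : `|s| < d / 2 -> is_derive s (1 : R) (g_ k.+1 - P)
      (F (g_ k s) - F (g s)).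
    move=> sd; have ? := dg k s (d2d s (ltW sd)); have ? := dP' s sd.
    exact: is_deriveB.
  have := derive_bound_row C0 D _ z02 td.
  rewrite -[(_ - _) t]/(g_ k.+1 t - P t).
  rewrite -[(_ - _) 0]/(g_ k.+1 0 - P 0) g0 P0 !subr0 => H.
  have {}H : `|g_ k.+1 t - P t - p| <= L * (2 * (B * d) * 2^-1 ^+ k) * `|t|.
    apply: H => s sd; apply: le_trans (FL _ _) _; apply: ler_wpM2l => //.
    exact/gP/d2d/ltW.
  have G := gP t td' k.+1.
  have : `|g t - (p + P t)| <= `|g_ k.+1 t - g t| + `|g_ k.+1 t - P t - p|.
    rewrite (_ : g t - (p + P t) = - (g_ k.+1 t - g t) + (g_ k.+1 t - P t - p)).
      by apply: le_trans (ler_normD _ _) _; rewrite normrN.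
    by rewrite opprB -[_ - P t - p]addrA subrKA opprD [- p + _]addrC.
  have : L * (2 * (B * d) * 2^-1 ^+ k) * `|t| <= L * (2 * (B * d) * 2^-1 ^+ k) * d.
    by apply: ler_wpM2l => //; exact: ltW.
  have : 2 * (B * d) * 2^-1 ^+ k.+1 <= 2 * (B * d) * 2^-1 ^+ k.
    have := (exprn_ge0 k (_ : 0 <= 2^-1 :> R)); rewrite exprS; nra.
  have -> : (2 * (B * d) + L * (2 * (B * d)) * d) * 2^-1 ^+ k =
      2 * (B * d) * 2^-1 ^+ k + L * (2 * (B * d) * 2^-1 ^+ k) * d by ring.
  lra.
exists (d / 2) => //; exists (fun t => p + P t); first by rewrite P0 addr0.
move=> t td; rewrite -gE //.
rewrite -[F (g t)]add0r.
exact: (is_deriveD (is_derive_cst p t (1 : R)) (dP' t td)).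
Qed.

End Picard.

(** * First and second order estimates on cubes *)

Section Cubes.
Variables (R : realType) (n : nat).
Implicit Types (p z w : 'rV[R]_n) (V : set 'rV[R]_n) (f : 'rV[R]_n -> R).

Definition cube p (r : R) : set 'rV[R]_n := [set z | `|z - p| <= r].
Definition open_cube p (r : R) : set 'rV[R]_n := [set z | `|z - p| < r].

Lemma open_open_cube p r : open (open_cube p r).
Proof.
have -> : open_cube p r = ball p r.
  by rewrite -ball_normE; apply/seteqP; split=> z /=; rewrite distrC.
exact: ball_open.
Qed.

Lemma cube_sub_open p r s : r < s -> cube p r `<=` open_cube p s.
Proof. by move=> rs z zr; exact: le_lt_trans rs. Qed.

Lemma open_cubeP V p : open V -> V p -> exists2 r : R, 0 < r & open_cube p r `<=` V.
Proof.
move=> oV Vp; have [r r0 rV] : exists2 r : R, 0 < r & ball p r `<=` V.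
  by have /nbhs_ballP[r r0 ?] := open_nbhs_nbhs (conj oV Vp); exists r.
exists r => // z zr; apply: rV; rewrite -ball_normE /=.
by rewrite distrC.
Qed.

Lemma compact_cube p r : compact (cube p r).
Proof.
apply: bounded_closed_compact.
  exists (`|p| + r); split; first exact: num_real.
  move=> M HM z zr; rewrite -[z](subrK p); apply: le_trans (ler_normD _ _) _.
  by apply: le_trans (ltW HM); rewrite addrC lerD2l.
have -> : cube p r = (fun z => `|z - p|) @^-1` [set x | x <= r] by [].
apply: preimage_closed; last exact: closed_le.
move=> z _; apply: continuous_comp; last exact: norm_continuous.
by apply: continuousB; [exact: cvg_id|exact: cst_continuous].
Qed.

Lemma cube_bounded p r f : (forall z, cube p r z -> {for z, continuous f}) ->
  exists2 M : R, 0 <= M & forall z, cube p r z -> `|f z| <= M.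
Proof.
move=> cf; have K : compact (f @` cube p r).
  apply: continuous_compact; last exact: compact_cube.
  by apply: continuous_in_subspaceT => z; rewrite inE; exact: cf.
have [M [Mr HM]] := compact_bounded K.
exists (`|M| + 1); first exact: addr_ge0.
move=> z zr; apply: HM; last by exists z.
by apply: le_lt_trans (ler_norm _) _; rewrite ltrDl.
Qed.

Lemma cube_convex p r z w (t : R) : 0 <= t <= 1 -> cube p r z -> cube p r w ->
  cube p r (z + t *: (w - z)).
Proof.
move=> /andP[t0 t1]; rewrite /cube /= => zr wr.
have -> : z + t *: (w - z) - p = (1 - t) *: (z - p) + t *: (w - p).
  by apply/rowP => i; rewrite !mxE; ring.
apply: le_trans (ler_normD _ _) _; rewrite !normrZ.
have t10 : 0 <= 1 - t by rewrite subr_ge0.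
rewrite (ger0_norm t0) (ger0_norm t10).
by have := ler_wpM2l t0 wr; have := ler_wpM2l t10 zr; lra.
Qed.

Lemma is_derive_line z (v : 'rV[R]_n) (t : R) :
  is_derive t (1 : R) (fun s : R => z + s *: v) v.
Proof.
apply: is_derive_rowP => i.
have -> : (fun s : R => (z + s *: v) 0 i) = (fun s => z 0 i + s * v 0 i).
  by apply/funext => s; rewrite !mxE.
have H : is_derive t (1 : R) (fun s : R => s * v 0 i) (v 0 i).
  apply: is_derive_eq (_ : _ = v 0 i).
  by rewrite scaler0 add0r /GRing.scale /= mulr1.
by have := is_deriveD (is_derive_cst (z 0 i) t (1 : R)) H; rewrite add0r.
Qed.

Lemma mean_value_cube p r f z w : (forall z, cube p r z -> differentiable f z) ->
  cube p r z -> cube p r w -> exists2 u, cube p r u &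
    `|u - z| <= `|w - z| /\ f w - f z = \sum_i (w - z) 0 i * partial i f u.
Proof.
move=> df zr wr; pose c (s : R) := z + s *: (w - z).
have dc (s : R) : s \in `[0, 1] -> is_derive s (1 : R) (f \o c)
    (\sum_i (w - z) 0 i * partial i f (c s)).
  rewrite in_itv => s01; apply: is_derive_curve; last exact: is_derive_line.
  exact/df/cube_convex.
pose df' (s : R) : R := \sum_i (w - z) 0 i * partial i f (c s).
have {}dc (s : R) : s \in `[0, 1] -> is_derive s (1 : R) (f \o c) (df' s) := dc s.
have cc : {within `[0, 1], continuous (f \o c)}.
  by apply: derivable_within_continuous => s /dc [].
have doo (s : R) : s \in `]0, 1[ -> is_derive s (1 : R) (f \o c) (df' s).
  by move=> s01; apply/dc/subset_itv_oo_cc.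
have [s s01 E] := MVT_segment ler01 doo cc.
move: (s01); rewrite in_itv => /= /[dup] s01' /andP[s0 s1].
exists (c s); first exact: cube_convex.
split; last first.
  have c1 : c 1 = w by rewrite /c scale1r addrC subrK.
  have c0 : c 0 = z by rewrite /c scale0r addr0.
  by move: E; rewrite /= c1 c0 subr0 mulr1.
rewrite /c addrC addKr normrZ (ger0_norm s0) -[leRHS]mul1r.
exact: ler_wpM2r.
Qed.

Lemma cube_lipschitz V p r f : open V -> cube p r `<=` V -> Cinfty_on V f ->
  exists2 L : R, 0 <= L & forall z w, cube p r z -> cube p r w ->
    `|f w - f z| <= L * `|w - z|.
Proof.
move=> oV pV Cf.
have /choice[M HM] : forall i, exists M : R, 0 <= M /\
    forall z, cube p r z -> `|partial i f z| <= M.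
  move=> i; have [|M M0 HM] := @cube_bounded p r (partial i f); last by exists M.
  by move=> z /pV; apply: Cinfty_on_continuous; exact: Cinfty_on_partial.
exists (\sum_i M i); first by apply: sumr_ge0 => i _; exact: (HM i).1.
move=> z w zr wr.
have df u : cube p r u -> differentiable f u.
  by move=> /pV; exact: Cinfty_on_differentiable.
have [u ur [_ ->]] := mean_value_cube df zr wr.
rewrite mulr_suml; apply: le_trans (ler_norm_sum _ _ _) _.
apply: ler_sum => i _; rewrite normrM mulrC; apply: ler_pM => //.
  exact: (HM i).2.
exact: row_norm_coord.
Qed.

(** The remainder is quadratic because the partial derivatives are Lipschitz on
    the cube. *)
Lemma taylor2 V p r f : open V -> cube p r `<=` V -> Cinfty_on V f ->
  exists2 C : R, 0 <= C & forall z w, cube p r z -> cube p r w ->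
    `|f w - f z - \sum_i (w - z) 0 i * partial i f z| <= C * `|w - z| ^+ 2.
Proof.
move=> oV pV Cf.
have /choice[L HL] : forall i, exists L : R, 0 <= L /\
    forall z w, cube p r z -> cube p r w ->
      `|partial i f w - partial i f z| <= L * `|w - z|.
  move=> i; have [L L0 HL] := cube_lipschitz oV pV (Cinfty_on_partial i Cf).
  by exists L.
exists (\sum_i L i); first by apply: sumr_ge0 => i _; exact: (HL i).1.
move=> z w zr wr.
have df u : cube p r u -> differentiable f u.
  by move=> /pV; exact: Cinfty_on_differentiable.
have [u ur [uz ->]] := mean_value_cube df zr wr.
rewrite -sumrB mulr_suml; apply: le_trans (ler_norm_sum _ _ _) _.
apply: ler_sum => i _; rewrite -mulrBr normrM expr2 mulrCA.
apply: ler_pM => //; first exact: row_norm_coord.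
apply: le_trans ((HL i).2 _ _ zr ur) _.
apply: ler_wpM2l => //; exact: (HL i).1.
Qed.

End Cubes.

(** * Solutions of smooth differential equations *)

Section LocalODE.
Variables (R : realType) (n : nat).
Implicit Types (p z w : 'rV[R]_n) (V : set 'rV[R]_n) (f : 'rV[R]_n -> R).

(** The coordinates are clamped to a small closed cube, which makes the
    right-hand side globally bounded and Lipschitz; the solution starts at the
    centre of the cube and so does not leave it for a short time. *)
Lemma local_ode V p (b : 'I_n -> 'rV[R]_n -> R) : open V -> V p ->
  (forall i, Cinfty_on V (b i)) ->
  exists2 d : R, 0 < d & exists2 g : R -> 'rV[R]_n, g 0 = p &
    forall t : R, `|t| < d ->
      V (g t) /\ is_derive t (1 : R) g (\row_i b i (g t)).
Proof.
move=> oV Vp Cb; have [r r0 rV] := open_cubeP oV Vp.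
have s0 : 0 < r / 2 by rewrite divr_gt0.
have sr : r / 2 < r by lra.
have sV : cube p (r / 2) `<=` V by move=> z zs; apply/rV/(cube_sub_open sr).
pose q z : 'rV[R]_n := \row_i (p 0 i + clamp (r / 2) (z 0 i - p 0 i)).
have qs z : cube p (r / 2) (q z).
  apply: row_norm_le => [|i]; first exact: ltW.
  by rewrite !mxE addrC addKr clamp_le // ltW.
have qL z w : `|q w - q z| <= `|w - z|.
  apply: row_norm_le => // i; rewrite !mxE opprD addrACA subrr add0r.
  apply: le_trans (clamp_lipschitz _ _ _) _.
  apply: le_trans (row_norm_coord _ i).
  by rewrite !mxE opprB addrA subrK.
have qid z : cube p (r / 2) z -> q z = z.
  move=> zs; apply/rowP => i; rewrite mxE clamp_id; first by rewrite addrC subrK.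
  by have := row_norm_coord (z - p) i; rewrite !mxE => H; exact: le_trans H zs.
have /choice[L HL] : forall i, exists L : R, 0 <= L /\
    forall z w, cube p (r / 2) z -> cube p (r / 2) w ->
      `|b i w - b i z| <= L * `|w - z|.
  by move=> i; have [L L0 HL] := cube_lipschitz oV sV (Cb i); exists L.
have /choice[B HB] : forall i, exists B : R, 0 <= B /\
    forall z, cube p (r / 2) z -> `|b i z| <= B.
  move=> i; have [|B B0 HB] := @cube_bounded _ _ p (r / 2) (b i).
    by move=> z /sV; exact: Cinfty_on_continuous.
  by exists B.
have [||z|d d0 [g g0 dg]] := @picard _ n (fun z => \row_i b i (q z))
    (\sum_i L i) (\sum_i B i) p.
- by apply: sumr_ge0 => i _; exact: (HL i).1.
- move=> z w; apply: row_norm_le => [|i].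
    by rewrite mulr_ge0 // sumr_ge0 // => i _; exact: (HL i).1.
  rewrite !mxE; apply: le_trans ((HL i).2 _ _ (qs z) (qs w)) _.
  apply: ler_pM => //; first exact: (HL i).1.
  by rewrite (bigD1 i) //= lerDl sumr_ge0 // => j _; exact: (HL j).1.
- apply: row_norm_le => [|i].
    by rewrite sumr_ge0 // => i _; exact: (HB i).1.
  rewrite !mxE; apply: le_trans ((HB i).2 _ (qs z)) _.
  by rewrite (bigD1 i) //= lerDl sumr_ge0 // => j _; exact: (HB j).1.
have cg : {for 0, continuous g}.
  apply: differentiable_continuous; apply/derivable1_diffP.
  by have [|//] := dg 0; rewrite normr0.
have [e e0 He] : exists2 e : R, 0 < e &
    forall t, `|t| < e -> cube p (r / 2) (g t).
  have := cg _ (open_nbhs_nbhs (conj (open_open_cube (r := r / 2)) _)).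
  rewrite g0 => /(_ p) /=; rewrite /open_cube /= subrr normr0 => /(_ s0).
  move=> /nbhs_ballP[e e0 He]; exists e => // t te.
  apply: ltW; apply: He; rewrite -ball_normE /= sub0r normrN //.
exists (Num.min d e); first by rewrite lt_min d0 e0.
exists g => // t; rewrite lt_min => /andP[td te].
split; first exact/sV/He.
by have := dg t td; rewrite qid //; exact: He.
Qed.

End LocalODE.

(** * Hadamard's lemma *)

Section Hadamard.
Variables (R : realType) (n : nat) (p : 'rV[R]_n) (r : R).
Hypothesis r0 : 0 < r.
Implicit Types (z w h : 'rV[R]_n) (f : 'rV[R]_n -> R) (m : nat).
Local Notation V := (open_cube p r).
Let oV : open V := @open_open_cube R n p r.

(** For t in [0, 1] this is the segment from [p] to [z]; the clamp keeps it in the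
    cube, and thus the integrands below continuous, for every t. *)
Definition ray z (t : R) : 'rV[R]_n := p + clamp 1 t *: (z - p).

(** The number [v] is the integral over [0, 1] of t^m f(p + t (z - p)). *)
Definition radial m f z (v : R) : Prop := exists P : R -> R,
  [/\ P 0 = 0, v = P 1 & forall t : R, `|t| < 2 ->
    is_derive t (1 : R) P (clamp 1 t ^+ m * f (ray z t))].

Lemma ray_cube z s (t : R) : cube p s z -> cube p s (ray z t).
Proof.
rewrite /cube /= /ray [p + _]addrC addrK normrZ => zs.
by apply: le_trans _ zs; rewrite ler_piMl // clamp_le.
Qed.

Lemma radial_ex m f z : Cinfty_on V f -> V z -> exists v, radial m f z v.
Proof.
move=> Cf Vz.
have [|P P0 dP] := @antiderivative _ (fun t => clamp 1 t ^+ m * f (ray z t)) 2.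
  move=> t; apply: cvgM.
    apply: (@continuous_comp _ _ _ (clamp 1) (fun u => u ^+ m)).
      exact: clamp_continuous.
    exact: exprn_continuous.
  apply: (@continuous_comp _ _ _ (ray z) f).
    apply: cvgD; first exact: cvg_cst.
    by apply: cvgZr_tmp; exact: clamp_continuous.
  apply: (Cinfty_on_continuous Cf).
  have H : cube p `|z - p| (ray z t) by apply: ray_cube; rewrite /cube /=.
  exact: le_lt_trans H Vz.
by exists (P 1); exists P.
Qed.

Lemma radial_uniq m f z u v : radial m f z u -> radial m f z v -> u = v.
Proof.
move=> [P [P0 -> dP]] [Q [Q0 -> dQ]].
have D (t : R) : `|t| < 2 -> is_derive t (1 : R) (P - Q) 0.
  move=> t2; have ? := dP t t2; have ? := dQ t t2.
  by apply: is_derive_eq (subrr _).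
apply/eqP; rewrite -subr_eq0 -normr_le0.
have M0 (t : R) : `|t| < 2 -> `|0 : R| <= 0 by rewrite normr0.
have l0 : `|0 : R| < 2 by rewrite normr0.
have l1 : `|1 : R| < 2 by rewrite normr1 ltr1n.
have := derive_bound D M0 l0 l1.
by rewrite -[(_ - _) 1]/(P 1 - Q 1) -[(_ - _) 0]/(P 0 - Q 0) P0 Q0 !subr0 mul0r.
Qed.

Definition radial_mean m f z : R := xget 0 (radial m f z).

Lemma radial_meanP m f z : Cinfty_on V f -> V z ->
  radial m f z (radial_mean m f z).
Proof. by move=> Cf Vz; have [v Hv] := radial_ex m Cf Vz; exact: (xgetI _ Hv). Qed.

Definition row_form (a : 'I_n -> R) h : R := \sum_i h 0 i * a i.

Lemma row_form_linear a : linear (row_form a).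
Proof.
move=> c u v; rewrite /row_form scaler_sumr -big_split; apply: eq_bigr => i _.
by rewrite !mxE mulrDl -mulrA.
Qed.

Lemma row_form_continuous a : continuous (row_form a).
Proof.
move=> z; have H : Cinfty_on setT (row_form a).
  apply: Cinfty_on_sum; first exact: openT.
  move=> i; apply: (@Cinfty_onM _ _ _ openT _ (cst (a i))).
    exact: Cinfty_on_coord.
  exact: Cinfty_on_cst.
exact: (Cinfty_on_continuous H).
Qed.

(** Differentiating under the integral sign multiplies the integrand by t: the
    i-th partial derivative of the integral with weight t^m is the integral of
    the i-th partial derivative with weight t^(m+1). The class of these integrals
    is therefore closed under partial derivatives, and consists of smooth
    functions ([Cinfty_on_radial]). *)
Lemma is_diff_radial m f z : Cinfty_on V f -> V z ->
  is_diff z (radial_mean m f)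
    (row_form (fun i => radial_mean m.+1 (partial i f) z)).
Proof.
move=> Cf Vz; set a := fun i => _.
pose lin := GRing.isLinear.Build _ _ _ _ _ (row_form_linear a).
pose L : {linear 'rV[R]_n -> R} := HB.pack (row_form a) lin.
rewrite -[row_form a]/(L : _ -> _).
(* [s] leaves room for small increments inside the open cube. *)
pose s := (`|z - p| + r) / 2.
have zr : `|z - p| < r by [].
have zs : `|z - p| < s by rewrite /s; lra.
have sr : s < r by rewrite /s; lra.
have sV : cube p s `<=` V by move=> w; exact: cube_sub_open.
have [C C0 HC] := taylor2 oV sV Cf.
have /choice[Q HQ] : forall i, exists P : R -> R, [/\ P 0 = 0, a i = P 1 &
    forall t : R, `|t| < 2 ->
    is_derive t (1 : R) P (clamp 1 t ^+ m.+1 * partial i f (ray z t))].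
  by move=> i; apply: (radial_meanP m.+1 _ Vz); exact: Cinfty_on_partial.
apply: is_diff_approx; first exact: row_form_continuous.
move=> e e0.
have nearV : \forall h \near (0 : 'rV[R]_n), `|h| < s - `|z - p|.
  by apply: near_norm_lt; rewrite normr0; lra.
have nearC : \forall h \near (0 : 'rV[R]_n), `|h| < e / (C + 1).
  by apply: near_norm_lt; rewrite normr0 divr_gt0 // ltr_wpDl.
apply: filterS2 nearV nearC => h hs he.
have wz : cube p s (h + z).
  rewrite /cube /= -addrA; apply: le_trans (ler_normD _ _) _.
  by rewrite -lerBrDr ltW.
have [S [S0 -> dS]] := radial_meanP m Cf (sV _ wz).
have [P' [P'0 -> dP']] := radial_meanP m Cf Vz.
pose D t := S t - P' t - \sum_i h 0 i * Q i t.
have dD (t : R) : `|t| < 2 -> is_derive t (1 : R) D (clamp 1 t ^+ m *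
    (f (ray (h + z) t) - f (ray z t) -
     \sum_i (ray (h + z) t - ray z t) 0 i * partial i f (ray z t))).
  move=> t2.
  have sumE : is_derive t (1 : R) (fun u => \sum_i h 0 i * Q i u)
      (\sum_i h 0 i * (clamp 1 t ^+ m.+1 * partial i f (ray z t))).
    have H i : is_derive t (1 : R) (fun u => h 0 i * Q i u)
        (h 0 i * (clamp 1 t ^+ m.+1 * partial i f (ray z t))).
      by have [_ _ /(_ t t2) ?] := HQ i; exact: is_deriveZ.
    have -> : (fun u => \sum_i h 0 i * Q i u) =
        \sum_i (fun u => h 0 i * Q i u) by apply/funext => u; rewrite fct_sumE.
    exact: is_derive_sum.
  have H : is_derive t (1 : R) D _ := is_deriveB (is_deriveB (dS t t2) (dP' t t2)) sumE.
  apply: (is_derive_eq H); rewrite -mulrBr [RHS]mulrBr; congr (_ - _).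
  rewrite mulr_sumr; apply: eq_bigr => i _.
  by rewrite /ray !mxE exprS; ring.
have D1 : `|D 1 - D 0| <= C * `|h| ^+ 2 * `|1 - 0|.
  apply: (derive_bound dD); rewrite ?normr0 ?normr1 ?ltr1n // => t _.
  rewrite normrM -[leRHS]mul1r; apply: ler_pM => //.
    by rewrite normrX exprn_ile1 // clamp_le.
  have zs' : cube p s z by exact: ltW.
  apply: le_trans (HC _ _ (ray_cube t zs') (ray_cube t wz)) _.
  apply: ler_wpM2l => //; apply: lerXn2r; rewrite ?nnegrE //.
  rewrite (_ : _ - _ = clamp 1 t *: h).
    by rewrite normrZ ler_piMl // clamp_le.
  by apply/rowP => i; rewrite /ray !mxE; ring.
have -> : S 1 - (P' 1 + L h) = D 1 - D 0.
  have sum0 : \sum_i h 0 i * Q i 0 = 0.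
    by rewrite big1 // => i _; have [-> _ _] := HQ i; rewrite mulr0.
  rewrite /D S0 P'0 sum0 !subr0 opprD addrA; congr (_ - _).
  by apply: eq_bigr => i _; have [_ <- _] := HQ i.
apply: le_trans D1 _.
rewrite subr0 normr1 mulr1 expr2 mulrA; apply: ler_wpM2r => //.
move: he; rewrite ltr_pdivlMr ?ltr_wpDl // => he.
by apply: le_trans (ltW he); rewrite mulrC ler_wpM2l // lerDl.
Qed.

Lemma Cinfty_on_radial m f : Cinfty_on V f -> Cinfty_on V (radial_mean m f).
Proof.
move=> Cf k; elim: k m f Cf => [|k IHk] m f Cf /=.
  move=> z Vz; have dz := is_diff_radial m Cf Vz.
  by apply: differentiable_continuous; exact: ex_diff.
split=> [z Vz|i]; first by have dz := is_diff_radial m Cf Vz; exact: ex_diff.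
apply: Ck_on_ext oV _ (IHk m.+1 _ (Cinfty_on_partial i Cf)) => z Vz.
have dz := is_diff_radial m Cf Vz.
rewrite deriveE ?diff_val; last exact: ex_diff.
rewrite /row_form (bigD1 i) //= big1 ?addr0 ?mxE ?eqxx ?mul1r // => j ji.
by rewrite mxE eqxx (negPf ji) mul0r.
Qed.

(** The coefficients are the integrals of the partial derivatives along the
    segments issued from [p]. *)
Lemma hadamard f : Cinfty_on V f -> exists g : 'I_n -> 'rV[R]_n -> R,
  [/\ forall i, Cinfty_on V (g i), forall i, g i p = partial i f p &
    forall z, V z -> f z = f p + \sum_i (z 0 i - p 0 i) * g i z].
Proof.
move=> Cf; have Cd i : Cinfty_on V (partial i f) by exact: Cinfty_on_partial.
have Vp : V p by rewrite /open_cube /= subrr normr0.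
exists (fun i => radial_mean 0 (partial i f)); split=> [i|i|z Vz].
- exact: Cinfty_on_radial.
- apply: (radial_uniq (radial_meanP 0 (Cd i) Vp)).
  exists (fun t => t * partial i f p); split; first by rewrite mul0r.
    by rewrite mul1r.
  move=> t _; rewrite expr0 mul1r /ray subrr scaler0 addr0.
  have H : is_derive t (1 : R) (fun s : R => s * partial i f p) _ :=
    is_deriveM (is_derive_id t (1 : R)) (is_derive_cst (partial i f p) t (1 : R)).
  apply: (is_derive_eq H).
  by rewrite scaler0 add0r /GRing.scale /= mulr1.
have /choice[Q HQ] : forall i, radial 0 (partial i f) z
    (radial_mean 0 (partial i f) z).
  by move=> i; exact: radial_meanP.
pose c (t : R) := p + t *: (z - p).
have rayE (t : R) : `|t| <= 1 -> ray z t = c t by move=> t1; rewrite /ray clamp_id.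
pose D t := f (c t) - \sum_i (z - p) 0 i * Q i t.
have dD (t : R) : t \in `[0, 1] -> is_derive t (1 : R) D 0.
  rewrite in_itv /= => /andP[t0 t1].
  have tn : `|t| <= 1 by rewrite ger0_norm.
  have t2 : `|t| < 2 by apply: le_lt_trans tn _; rewrite ltr1n.
  have Vc : V (c t).
    rewrite -rayE //.
    have H : cube p `|z - p| (ray z t) by apply: ray_cube; rewrite /cube /=.
    exact: le_lt_trans H Vz.
  have df := is_derive_curve (Cinfty_on_differentiable Cf Vc)
    (is_derive_line p (z - p) t).
  have sumE : is_derive t (1 : R) (fun u => \sum_i (z - p) 0 i * Q i u)
      (\sum_i (z - p) 0 i * partial i f (c t)).
    have H i : is_derive t (1 : R) (fun u => (z - p) 0 i * Q i u)
        ((z - p) 0 i * partial i f (c t)).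
      have [_ _ /(_ t t2)] := HQ i; rewrite expr0 mul1r rayE // => ?.
      exact: is_deriveZ.
    have -> : (fun u => \sum_i (z - p) 0 i * Q i u) =
        \sum_i (fun u => (z - p) 0 i * Q i u) by apply/funext => u; rewrite fct_sumE.
    exact: is_derive_sum.
  have H : is_derive t (1 : R) D _ := is_deriveB df sumE.
  by apply: (is_derive_eq H); rewrite subrr.
have cD : {within `[0, 1], continuous D}.
  by apply: derivable_within_continuous => t /dD [].
have doo (t : R) : t \in `]0, 1[ -> is_derive t (1 : R) D ((fun=> 0) t).
  by move=> t01; apply/dD/subset_itv_oo_cc.
have [t _] := MVT_segment ler01 doo cD.
rewrite mul0r => /eqP; rewrite subr_eq0 => /eqP.
have sum0 : \sum_i (z - p) 0 i * Q i 0 = 0.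
  by rewrite big1 // => i _; have [-> _ _] := HQ i; rewrite mulr0.
rewrite /D sum0 subr0 /c scale0r addr0 scale1r [p + _]addrC subrK.
move=> /eqP; rewrite subr_eq => /eqP ->; congr (_ + _).
by apply: eq_bigr => i _; have [_ -> _] := HQ i; rewrite !mxE.
Qed.

End Hadamard.

(** * Tangent vectors as derivations at a point *)

Section Tangent.
Variables (R : realType) (D : smooth_space R).
Implicit Types (x : D) (f g : cinf D) (xi : cinf D -> R).

Section TangentVector.
Variables (x : D) (xi : cinf D -> R).
Hypothesis txi : tangent_vector x xi.

Lemma tangentD f g : xi (f + g) = xi f + xi g.
Proof. by rewrite -[f in LHS]scale1r txi.1 mul1r. Qed.

Lemma tangent0 : xi 0 = 0.
Proof. by apply: (addrI (xi 0)); rewrite -tangentD !addr0. Qed.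

Lemma tangentZ (a : R) f : xi (a *: f) = a * xi f.
Proof. by rewrite -[a *: f]addr0 txi.1 tangent0 addr0. Qed.

Lemma tangentB f g : xi (f - g) = xi f - xi g.
Proof. by rewrite -scaleN1r tangentD tangentZ mulN1r. Qed.

Lemma tangent1 : xi 1 = 0.
Proof.
have := txi.2 1 1; rewrite mulr1 -[(1 : cinf D) x]/(1 : R) mulr1 mul1r.
by move=> H; apply: (addrI (xi 1)); rewrite addr0 -H.
Qed.

Lemma tangent_sum (I : Type) (r : seq I) (F : I -> cinf D) :
  xi (\sum_(i <- r) F i) = \sum_(i <- r) xi (F i).
Proof.
elim: r => [|i r IHr]; first by rewrite !big_nil tangent0.
by rewrite !big_cons tangentD IHr.
Qed.

Lemma tangent_cst f (a : R) : (forall y, f y = a) -> xi f = 0.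
Proof.
move=> fa; have -> : f = a *: (1 : cinf D).
  by apply/val_inj/funext => y; rewrite -[LHS]/(f y) fa -[RHS]/(a * (1 : R)) mulr1.
by rewrite tangentZ tangent1 mulr0.
Qed.

End TangentVector.

(** This is what makes derivations local ([tangent_local]). *)
Definition bumpy : Prop := forall x (U : set D), nbhs x U ->
  exists2 rho : cinf D, rho x != 0 & forall y, ~ U y -> rho y = 0.

(** If [rho] is supported where [f] and [g] agree then rho (f - g) = 0, and the
    Leibniz rule at [x] leaves rho(x) xi(f - g) = 0. *)
Lemma tangent_local x xi f g : bumpy -> tangent_vector x xi ->
  (\forall y \near x, f y = g y) -> xi f = xi g.
Proof.
move=> bD txi fg; have [rho rx r0] := bD x _ fg.
have E : rho * (f - g) = 0.
  apply/val_inj/funext => y; rewrite -[LHS]/(rho y * (f y - g y)).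
  have [->|nfg] := pselect (f y = g y); first by rewrite subrr mulr0.
  by rewrite r0 // mul0r.
have := txi.2 rho (f - g); rewrite E (tangent0 txi).
rewrite -[(f - g) x]/(f x - g x) (nbhs_singleton fg) subrr mulr0 add0r.
rewrite (tangentB txi) => /esym/eqP; rewrite mulf_eq0 (negPf rx) /= subr_eq0.
by move/eqP.
Qed.

End Tangent.

Section Charts.
Variables (R : realType) (D : smooth_space R) (n : nat) (c : chart D n).
Implicit Types (x : D) (f g : cinf D).
Local Notation O := (chart_map c @` chart_dom c).

Lemma chart_mapK p : O p -> chart_map c (chart_inv c p) = p.
Proof. by move=> [x dx <-]; rewrite chartK. Qed.

Lemma chart_inv_dom p : O p -> chart_dom c (chart_inv c p).
Proof. by move=> [x dx <-]; rewrite chartK. Qed.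

Lemma chart_near_dom x : chart_dom c x -> \forall y \near x, chart_dom c y.
Proof. by move=> dx; apply: open_nbhs_nbhs; split=> //; exact: chart_open. Qed.

Lemma Cinfty_on_chart f : Cinfty_on O (f \o chart_inv c).
Proof.
apply/(chart_smooth c f) => x _; exists f; first exact: cinfP.
exact: nearW.
Qed.

(** The characterization of smoothness in a chart provides the extension to the
    whole space. *)
Lemma chart_extend (a : 'rV[R]_n -> R) x : Cinfty_on O a -> chart_dom c x ->
  exists f : cinf D, \forall y \near x, f y = a (chart_map c y).
Proof.
move=> Ca dx; have [|f sf fa] := (chart_smooth c (a \o chart_map c)).2 _ x dx.
  apply: Cinfty_on_ext Ca; first exact: chart_open_image.
  by move=> p Op /=; rewrite chart_mapK.
by exists (mk_cinf sf); apply: filterS fa => y /esym.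
Qed.

(** The product with the bump function is smooth on R^n, although [a] is smooth
    on a cube only. Extending it by zero outside the chart is smooth because the
    image of a closed cube is compact, hence closed. *)
Lemma cutoff_extend (a : 'rV[R]_n -> R) x (r s : R) : hausdorff_space D ->
  chart_dom c x -> 0 < r -> r < s -> open_cube (chart_map c x) s `<=` O ->
  Cinfty_on (open_cube (chart_map c x) s) a ->
  exists2 f : cinf D, forall y, ~ chart_dom c y -> f y = 0 &
    forall y, chart_dom c y ->
      f y = ball_bump (chart_map c x) r (chart_map c y) * a (chart_map c y).
Proof.
set p := chart_map c x => hD dx r0 rs sO Ca.
pose a' := ball_bump p r * a.
have oC : open (~` cube p r).
  by rewrite openC; apply: compact_closed; [exact: norm_hausdorff|exact: compact_cube].
have Ca' : Cinfty_on setT a'.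
  have C1 : Cinfty_on (open_cube p s) a'.
    apply: Cinfty_onM => //; first exact: open_open_cube.
    by apply: Cinfty_on_ball_bump; exact: open_open_cube.
  have C2 : Cinfty_on (~` cube p r) a'.
    apply: Cinfty_on_ext (Cinfty_on_cst _ 0) => // z zr.
    by rewrite -[a' z]/(ball_bump p r z * a z) ball_bump_out ?mul0r // => /ltW.
  move=> k; apply: (@Ck_on_sub _ _ _ _ (open_cube p s `|` ~` cube p r)).
    move=> z _; have [/(cube_sub_open rs)|] := pselect (cube p r z); first by left.
    by right.
  exact: Ck_on_setU.
pose f y := if pselect (chart_dom c y) then a' (chart_map c y) else 0.
have fE y : chart_dom c y -> f y = a' (chart_map c y).
  by rewrite /f; case: pselect.
have fN y : ~ chart_dom c y -> f y = 0 by rewrite /f; case: pselect.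
pose K := chart_inv c @` cube p r.
have pO : cube p r `<=` O by move=> z zr; exact/sO/(cube_sub_open rs).
have cK : closed K.
  apply: compact_closed => //; apply: continuous_compact; last exact: compact_cube.
  apply: continuous_in_subspaceT => z; rewrite inE => zr.
  by apply: chart_inv_continuous; exact: pO.
have sf : smooth f.
  apply: smooth_local => y; have [dy|ndy] := pselect (chart_dom c y).
    have [|g sg fg] := (chart_smooth c f).2 _ y dy; last by exists g.
    apply: Cinfty_on_ext (fun k => Ck_on_sub (@subsetT _ _) (Ca' k)).
      exact: chart_open_image.
    by move=> z Oz /=; rewrite fE ?chart_mapK //; exact: chart_inv_dom.
  exists (cst 0); first exact: smooth_cst.
  have nKy : (~` K) y.
    by move=> [z zr zy]; apply: ndy; rewrite -zy; exact/chart_inv_dom/pO.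
  apply: filterS (open_nbhs_nbhs (conj (closed_openC cK) nKy)) => z nKz.
  have [dz|] := pselect (chart_dom c z); last exact: fN.
  rewrite fE // -[LHS]/(ball_bump p r (chart_map c z) * a (chart_map c z)).
  rewrite ball_bump_out ?mul0r // => zr; apply: nKz.
  by exists (chart_map c z); [exact: ltW|exact: chartK].
exists (mk_cinf sf) => y ny; first exact: fN.
by rewrite -[LHS]/(f y) fE.
Qed.

End Charts.

Section ManifoldBump.
Variables (R : realType) (M : smooth_space R) (n : nat).
Hypothesis mM : manifold M n.
Implicit Types (x : M) (f : cinf M).

Lemma chart_open_cube (c : chart M n) x (U : set M) : chart_dom c x -> nbhs x U ->
  exists s : R, [/\ 0 < s,
    open_cube (chart_map c x) s `<=` chart_map c @` chart_dom c &
    forall y, chart_dom c y -> open_cube (chart_map c x) s (chart_map c y) -> U y].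
Proof.
move=> dx Ux; have Op : (chart_map c @` chart_dom c) (chart_map c x) by exists x.
have oO := @chart_open_image _ _ _ c.
have Ux' : nbhs (chart_inv c (chart_map c x)) U by rewrite chartK.
have NU : nbhs (chart_map c x) (chart_inv c @^-1` U).
  exact: chart_inv_continuous Op _ Ux'.
have NO := open_nbhs_nbhs (conj oO Op).
have [s s0 sU] : exists2 s : R, 0 < s & ball (chart_map c x) s `<=`
    (chart_inv c @^-1` U) `&` (chart_map c @` chart_dom c).
  have /(nbhs_ballP (chart_map c x : 'rV[R]_n))[s ? ?] : nbhs (chart_map c x : 'rV[R]_n)
    ((chart_inv c @^-1` U) `&` (chart_map c @` chart_dom c)) by exact: filterI.
  by exists s.
have sE z : open_cube (chart_map c x) s z -> ball (chart_map c x) s z.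
  by rewrite -ball_normE /open_cube /= distrC.
exists s; split=> // [z /sE/sU[]//|y dy /sE/sU[/= + _]].
by rewrite chartK.
Qed.

Lemma manifold_bumpy : bumpy M.
Proof.
move=> x U Ux; have [hM _ /(_ x)[c dx]] := mM.
have [s [s0 sO sU]] := chart_open_cube dx Ux.
have s20 : 0 < s / 2 by rewrite divr_gt0.
have s2s : s / 2 < s by lra.
have [f f0 fE] := cutoff_extend hM dx s20 s2s sO
  (Cinfty_on_cst (open_cube (chart_map c x) s) 1).
exists f; first by rewrite fE // mulr1 gt_eqF // ball_bump_center.
move=> y nUy; have [dy|] := pselect (chart_dom c y); last exact: f0.
rewrite fE // ball_bump_out ?mul0r // => ys; apply/nUy/sU => //.
exact: lt_trans s2s.
Qed.

End ManifoldBump.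

Lemma cinf_sumE (R : realType) (D : smooth_space R) (I : Type) (r : seq I)
    (F : I -> cinf D) (x : D) : (\sum_(i <- r) F i) x = \sum_(i <- r) F i x.
Proof.
elim: r => [|i r IHr]; first by rewrite !big_nil.
by rewrite !big_cons -[LHS]/(F i x + (\sum_(j <- r) F j) x) IHr.
Qed.

Section TangentCoord.
Variables (R : realType) (M : smooth_space R) (n : nat).
Hypothesis mM : manifold M n.

(** By Hadamard's lemma and a cutoff [chi], chi (f - f(x)) is a sum of products
    of y_i - y_i(x) with smooth functions, up to equality near [x]; the Leibniz
    rule then evaluates [xi] on it. *)
Lemma tangent_coord (c : chart M n) (x : M) (y : 'I_n -> cinf M)
    (xi : cinf M -> R) (f : cinf M) : chart_dom c x ->
  (forall i, \forall z \near x, y i z = chart_map c z 0 i) ->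
  tangent_vector x xi ->
  xi f = \sum_i xi (y i) * partial i (f \o chart_inv c) (chart_map c x).
Proof.
move=> dx yE txi; set p := chart_map c x.
have [hM _ _] := mM; have bM := manifold_bumpy mM.
have [s [s0 sO _]] := chart_open_cube dx (@filterT _ (nbhs x) _).
have s20 : 0 < s / 2 by rewrite divr_gt0.
have s2s : s / 2 < s by lra.
have Cf : Cinfty_on (open_cube p s) (f \o chart_inv c).
  by move=> k; apply: Ck_on_sub sO _; exact: Cinfty_on_chart.
have [g [Cg gp fg]] := hadamard s0 Cf.
have [chi _ chiE] := cutoff_extend hM dx s20 s2s sO
  (Cinfty_on_cst (open_cube p s) 1).
have /choice[G GE] : forall i, exists G : cinf M, forall z, chart_dom c z ->
    G z = ball_bump p (s / 2) (chart_map c z) * g i (chart_map c z).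
  by move=> i; have [G _ GE] := cutoff_extend hM dx s20 s2s sO (Cg i); exists G.
have near_s : \forall z \near x, open_cube p s (chart_map c z).
  have Np : nbhs p (open_cube p s).
    apply: open_nbhs_nbhs; split; first exact: open_open_cube.
    by rewrite /open_cube /= subrr normr0.
  exact: chart_map_continuous dx _ Np.
pose u i : cinf M := y i - (p 0 i) *: (1 : cinf M).
have ux i : u i x = 0.
  rewrite -[LHS]/(y i x - p 0 i * (1 : R)) mulr1 (nbhs_singleton (yE i)).
  exact: subrr.
have xiu i : xi (u i) = xi (y i).
  by rewrite (tangentB txi) (tangentZ txi) (tangent1 txi) mulr0 subr0.
have near_y : \forall z \near x, forall i, y i z = chart_map c z 0 i.
  exact: filter_forall.
have E : xi (chi * (f - (f x) *: (1 : cinf M))) = xi (\sum_i u i * G i).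
  apply: (tangent_local bM txi).
  apply: filterS3 (chart_near_dom dx) near_s near_y => z dz sz yz.
  rewrite cinf_sumE -[LHS]/(chi z * (f z - f x * (1 : R))) mulr1.
  have := fg _ sz; rewrite /= chartK // -/p /p chartK // => ->.
  rewrite addrAC subrr add0r mulr_sumr; apply: eq_bigr => i _.
  rewrite -[RHS]/((y i z - p 0 i * (1 : R)) * G i z) mulr1 yz GE // chiE //.
  by rewrite mulr1 mulrCA.
have chi_x : chi x != 0 by rewrite chiE // mulr1 gt_eqF // ball_bump_center.
apply: (mulfI chi_x); move: E; rewrite txi.2 (tangent_sum txi).
rewrite -[(f - _) x]/(f x - f x * (1 : R)) mulr1 subrr mulr0 add0r.
rewrite (tangentB txi) (tangentZ txi) (tangent1 txi) mulr0 subr0 => ->.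
rewrite mulr_sumr; apply: eq_bigr => i _.
by rewrite txi.2 ux mul0r addr0 xiu GE // gp chiE // mulr1 mulrCA.
Qed.

End TangentCoord.

(** * Embedded spaces *)

Section Embedding.
Variable R : realType.
Implicit Types D E : smooth_space R.

(** The space [D] carries the topology and the smooth structure induced by [i],
    as a subspace of a subspace does. *)
Definition embedding D E (i : D -> E) : Prop :=
  [/\ forall f : cinf E, smooth (f \o i),
      forall (phi : cinf D) (x : D),
        exists f : cinf E, \forall y \near x, phi y = f (i y),
      continuous i &
      forall (x : D) U, nbhs x U -> exists2 V, nbhs (i x) V & i @^-1` V `<=` U].

Lemma sub_embedding D (A : set D) :
  embedding (set_val : sub_space A -> D).
Proof.
split.
- by move=> f; exact: restrict_smooth.
- move=> phi x; have [g gs pg] := cinfP phi x.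
  by exists (mk_cinf gs).
- exact: initial_continuous.
- move=> x U; rewrite nbhsE => -[W [[V oV VW] Wx] WU].
  exists V; last by rewrite VW.
  by apply: open_nbhs_nbhs; split=> //; move: Wx; rewrite -VW.
Qed.

Lemma embedding_comp D E (F : smooth_space R) (i : D -> E) (j : E -> F) :
  embedding i -> embedding j -> embedding (j \o i).
Proof.
move=> [i1 i2 i3 i4] [j1 j2 j3 j4]; split.
- by move=> f; exact: (i1 (mk_cinf (j1 f))).
- move=> phi x; have [f phif] := i2 phi x; have [g fg] := j2 f (i x).
  exists g; apply: filterS2 phif (i3 _ _ fg) => y -> /=.
  by [].
- by move=> x; apply: continuous_comp; [exact: i3|exact: j3].
- move=> x U /i4[V /j4[W jW WV] VU]; exists W => //.
  by move=> y Wy; apply/VU/WV.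
Qed.

Lemma embedding_bumpy D E (i : D -> E) : embedding i -> bumpy E -> bumpy D.
Proof.
move=> [i1 _ _ i4] bE x U /i4[V iV VU]; have [rho rx r0] := bE _ _ iV.
exists (mk_cinf (i1 rho)) => // y nUy; apply: r0 => Viy; apply: nUy.
exact: VU.
Qed.

Definition pull D E (i : D -> E) (ei : embedding i) (f : cinf E) : cinf D :=
  mk_cinf (let: And4 H _ _ _ := ei in H f).

Lemma pullE D E (i : D -> E) (ei : embedding i) f x : pull ei f x = f (i x).
Proof. by []. Qed.

Lemma push_tangent D E (i : D -> E) (ei : embedding i) x xi :
  tangent_vector x xi -> tangent_vector (i x) (xi \o pull ei).
Proof.
move=> [xil xim]; split=> [a f g|f g] /=.
  by rewrite -xil; congr xi; apply/val_inj/funext.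
by rewrite -[f (i x)]/(pull ei f x) -[g (i x)]/(pull ei g x) -xim; congr xi;
  apply/val_inj/funext.
Qed.

Lemma vfield_tangent D (Y : vfield D) x :
  tangent_vector x (fun phi => (Y phi : cinf D) x).
Proof. by have [Yl YM] := vfieldP Y; split=> [a f g|f g]; rewrite ?Yl ?YM. Qed.

End Embedding.

(** * Curves in a level surface *)

Section LevelCurves.
Variables (R : realType) (M : smooth_space R) (n : nat).
Hypothesis mM : manifold M n.
Variables (H : cinf M) (h : R) (D : smooth_space R) (i : D -> M).
Hypothesis ei : embedding i.
Hypothesis Hi : forall x, H (i x) = h.
Hypothesis full : forall x, \forall y \near i x, H y = h -> range i y.

Section LevelCurve.
Variables (c : chart M n) (x : D) (b : 'I_n -> 'rV[R]_n -> R).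
Local Notation O := (chart_map c @` chart_dom c).
Hypothesis dx : chart_dom c (i x).
Hypothesis Cb : forall j, Cinfty_on O (b j).
Hypothesis bH : \forall z \near chart_map c (i x),
  \sum_j b j z * partial j (H \o chart_inv c) z = 0.

(** The curve solves in the chart the equation with right-hand side [b]. It
    preserves [H], because [b] annihilates the differential of [H], so it stays on
    the level and lifts to [D]. *)
Lemma level_curve : exists2 d : R, 0 < d & exists2 gam : R -> D, gam 0 = x &
  forall t : R, `|t| < d -> [/\ chart_dom c (i (gam t)),
    {for t, continuous gam} &
    forall (phi : cinf D) (f : cinf M),
      (\forall y \near gam t, phi y = f (i y)) ->
      is_derive t (1 : R) (phi \o gam)
        (\sum_j b j (chart_map c (i (gam t))) *
           partial j (f \o chart_inv c) (chart_map c (i (gam t))))].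
Proof.
set p := chart_map c (i x).
have oO := @chart_open_image _ _ _ c.
have Op : O p by exists (i x).
have NO := open_nbhs_nbhs (conj oO Op).
have NN : nbhs p ([set z | \sum_j b j z * partial j (H \o chart_inv c) z = 0] `&` O).
  exact: filterI.
move: NN; rewrite nbhsE => -[V [oV Vp] VO].
have VO' : V `<=` O by move=> z /VO[].
have [d d0 [g g0 dg]] := @local_ode _ _ V p b oV Vp
  (fun j k => Ck_on_sub VO' (Cb j k)).
have Hg (t : R) : `|t| < d -> H (chart_inv c (g t)) = h.
  move=> td; have z0 : `|0 : R| < d by rewrite normr0.
  have dH (s : R) : `|s| < d -> is_derive s (1 : R) (H \o chart_inv c \o g) 0.
    move=> sd; have [Vs dgs] := dg s sd.
    have df : differentiable (H \o chart_inv c) (g s).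
      exact: (Cinfty_on_differentiable (Cinfty_on_chart c H) (VO' _ Vs)).
    apply: (is_derive_eq (is_derive_curve df dgs)).
    have [E _] := VO _ Vs; rewrite -[RHS]E.
    by apply: eq_bigr => j _; rewrite mxE.
  have M0 (s : R) : `|s| < d -> `|0 : R| <= 0 by rewrite normr0.
  have := derive_bound dH M0 z0 td; rewrite mul0r normr_le0 subr_eq0 => /eqP /=.
  by rewrite g0 chartK // Hi.
have cg (t : R) : `|t| < d -> {for t, continuous g}.
  move=> td; apply: differentiable_continuous; apply/derivable1_diffP.
  by have [_ []] := dg t td.
have cz (t : R) : `|t| < d -> {for t, continuous (chart_inv c \o g)}.
  move=> td; apply: continuous_comp; first exact: cg.
  by apply: chart_inv_continuous; apply: VO'; have [] := dg t td.
have z0 : `|0 : R| < d by rewrite normr0.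
have [e e0 He] : exists2 e : R, 0 < e & forall t : R, `|t| < e ->
    H (chart_inv c (g t)) = h -> range i (chart_inv c (g t)).
  have F := full x; rewrite -(chartK dx) -/p -g0 in F.
  have /nbhs_ballP[e e0 He] := cz 0 z0 _ F; exists e => // t te.
  by apply: He; rewrite -ball_normE /= sub0r normrN.
have /choice[gam0 Hgam0] : forall t, exists y, `|t| < Num.min d e ->
    i y = chart_inv c (g t).
  move=> t; have [|] := pselect (`|t| < Num.min d e); last by exists x.
  rewrite lt_min => /andP[td te]; have [y _ yE] := He t te (Hg t td).
  by exists y.
(* At time 0 the lift has to be [x] itself. *)
pose gam t := if t == 0 then x else gam0 t.
have gamE (t : R) : `|t| < Num.min d e -> i (gam t) = chart_inv c (g t).
  rewrite /gam; case: eqP => [-> _|_]; last exact: Hgam0.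
  by rewrite g0 chartK.
have near_e (t : R) : `|t| < Num.min d e ->
    \forall s \near t, i (gam s) = chart_inv c (g s).
  by move=> /near_norm_lt; apply: filterS => s; exact: gamE.
exists (Num.min d e); first by rewrite lt_min d0 e0.
exists gam; first by rewrite /gam eqxx.
move=> t te; have td : `|t| < d by move: te; rewrite lt_min => /andP[].
have [Vt dgt] := dg t td; have Ot := VO' _ Vt.
have cgam : {for t, continuous gam}.
  have [_ _ _ i4] := ei.
  move=> U /i4[W]; rewrite gamE // => /(cz t td) NW WU.
  have NW' : \forall s \near t, W (chart_inv c (g s)) by exact: NW.
  suff : \forall s \near t, U (gam s) by [].
  by apply: filterS2 NW' (near_e t te) => s Ws sE; apply: WU; rewrite /= sE.
split=> //; first by rewrite gamE //; exact: chart_inv_dom.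
move=> phi f phif; rewrite gamE // chart_mapK //.
have df : differentiable (f \o chart_inv c) (g t).
  exact: (Cinfty_on_differentiable (Cinfty_on_chart c f) Ot).
have E : is_derive t (1 : R) (f \o chart_inv c \o g)
    (\sum_j b j (g t) * partial j (f \o chart_inv c) (g t)).
  apply: (is_derive_eq (is_derive_curve df dgt)).
  by apply: eq_bigr => j _; rewrite mxE.
apply: near_eq_is_derive E.
have phif' : \forall s \near t, phi (gam s) = f (i (gam s)) by exact: cgam _ phif.
by apply: filterS2 (near_e t te) phif' => s sE /= ->; rewrite sE.
Qed.

End LevelCurve.

End LevelCurves.

Section NonCritical.
Variables (R : realType) (D : smooth_space R).

Lemma noncriticalP (f : cinf D) (x : D) : ~ critical f x <->
  exists2 xi, tangent_vector x xi & xi f != 0.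
Proof.
split=> [nc|[xi txi /eqP xif] /(_ xi txi)//].
apply: contrapT => nex; apply: nc => xi txi; apply: contrapT => /eqP xif.
by apply: nex; exists xi.
Qed.

End NonCritical.

Section Tilt.
Variables (R : realType) (n : nat) (eta b : 'I_n -> 'rV[R]_n -> R).

(** Up to the factor |eta|^2, this is the orthogonal projection of [b] to the
    hyperplane that [eta] annihilates. Without division it stays smooth, and it is
    |eta|^2 b at the points where [b] is already annihilated. *)
Definition tilt j z : R :=
  (\sum_k eta k z ^+ 2) * b j z - (\sum_k b k z * eta k z) * eta j z.

Lemma tiltE (a : 'I_n -> R) z : \sum_j tilt j z * a j =
  (\sum_k eta k z ^+ 2) * (\sum_j b j z * a j) -
  (\sum_k b k z * eta k z) * (\sum_j eta j z * a j).
Proof.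
rewrite !mulr_sumr -sumrB; apply: eq_bigr => j _.
by rewrite /tilt mulrBl -!mulrA.
Qed.

Lemma tilt_orth z : \sum_j tilt j z * eta j z = 0.
Proof.
rewrite tiltE mulrC; apply/eqP; rewrite subr_eq0; apply/eqP; congr (_ * _).
Qed.

Lemma Cinfty_on_tilt V j : open V -> (forall k, Cinfty_on V (eta k)) ->
  (forall k, Cinfty_on V (b k)) -> Cinfty_on V (tilt j).
Proof.
move=> oV Ce Cb; apply: Cinfty_onD => //.
  apply: (Cinfty_onM oV _ (Cb j)); apply: Cinfty_on_sum => // k.
  exact: (Cinfty_onM oV (Ce k) (Ce k)).
apply: Cinfty_onN => //; apply: (Cinfty_onM oV _ (Ce j)).
by apply: Cinfty_on_sum => // k; exact: Cinfty_onM.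
Qed.

End Tilt.

(** * Integral curves of fields on a level surface *)

Section FieldCurves.
Variables (R : realType) (M : smooth_space R) (n : nat).
Hypothesis mM : manifold M n.
Variables (H : cinf M) (h : R) (D : smooth_space R) (i : D -> M).
Hypothesis ei : embedding i.
Hypothesis Hi : forall x, H (i x) = h.
Hypothesis full : forall x, \forall y \near i x, H y = h -> range i y.
Variable x : D.
Hypothesis ncH : ~ critical H (i x).

Section Coordinates.
Variables (c : chart M n) (y : 'I_n -> cinf M).
Hypothesis dx : chart_dom c (i x).
Hypothesis yE : forall j, \forall z \near i x, y j z = chart_map c z 0 j.
Local Notation O := (chart_map c @` chart_dom c).
Local Notation eta := (fun j => partial j (H \o chart_inv c)).

(** The points where the coordinate formula holds are all the points near [x],
    since the coordinate functions coincide with the chart near each of them. *)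
Lemma level_tangent_coord : \forall w \near x,
  forall xi (phi : cinf D) (f : cinf M),
  tangent_vector w xi -> (\forall z \near w, phi z = f (i z)) ->
  xi phi = \sum_j xi (pull ei (y j)) *
    partial j (f \o chart_inv c) (chart_map c (i w)).
Proof.
have yE' : \forall w \near i x, chart_dom c w /\
    forall j, \forall z \near w, y j z = chart_map c z 0 j.
  apply: filterI; first exact: chart_near_dom.
  by apply: filter_forall => j; exact: nbhs_interior (yE j).
have [_ _ ci _] := ei.
have : \forall w \near x, chart_dom c (i w) /\
    forall j, \forall z \near i w, y j z = chart_map c z 0 j by exact: ci yE'.
apply: filterS => w [dw yw] xi phi f txi phif.
rewrite (tangent_local (embedding_bumpy ei (manifold_bumpy mM)) txi
  (g := pull ei f)) //.
exact: (tangent_coord mM f dw yw (push_tangent ei txi)).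
Qed.

(** By the coordinate formula, the differential of [H] does not vanish at a
    noncritical point. *)
Lemma sum_eta_neq0 : \sum_k eta k (chart_map c (i x)) ^+ 2 != 0.
Proof.
apply/eqP => /eqP; rewrite psumr_eq0; last by move=> k _; exact: sqr_ge0.
move=> /allP eta0; have /noncriticalP[xi txi /eqP] := ncH; apply.
rewrite (tangent_coord mM H dx yE txi) big1 // => j _.
by have := eta0 j (mem_index_enum j); rewrite /= sqrf_eq0 => /eqP ->; rewrite mulr0.
Qed.

Lemma level_tangent_H : \forall w \near x, forall xi, tangent_vector w xi ->
  \sum_j xi (pull ei (y j)) * eta j (chart_map c (i w)) = 0.
Proof.
apply: filterS level_tangent_coord => w E xi txi.
rewrite -(E xi (pull ei H) H txi); last exact: nearW.
by apply: (tangent_cst txi (a := h)) => z; rewrite pullE.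
Qed.

End Coordinates.

Lemma level_chart : exists (c : chart M n) (y : 'I_n -> cinf M),
  chart_dom c (i x) /\ forall j, \forall z \near i x, y j z = chart_map c z 0 j.
Proof.
have [_ _ /(_ (i x))[c dx]] := mM.
have /choice[y yE] : forall j, exists f : cinf M,
    \forall z \near i x, f z = chart_map c z 0 j.
  by move=> j; exact: (chart_extend (Cinfty_on_coord _ j) dx).
by exists c, y.
Qed.

(** The coefficients of [Y] extend to smooth functions of the ambient chart, but
    off the level they need not be tangent to the levels of [H]. Tilting them
    makes [level_curve] applicable, and on the level it only multiplies them by
    the squared length [k] of the differential of [H]. *)
Lemma field_curve (Y : vfield D) :
  exists2 d : R, 0 < d & exists gam : R -> D, exists k : R -> R,
  [/\ gam 0 = x, k 0 != 0 & forall t : R, `|t| < d ->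
    {for t, continuous gam} /\ forall phi : cinf D,
      is_derive t (1 : R) (phi \o gam) (k t * (Y phi : cinf D) (gam t))].
Proof.
have [c [y [dx yE]]] := level_chart.
have oO := @chart_open_image _ _ _ c.
pose eta j := partial j (H \o chart_inv c).
have Ce j : Cinfty_on (chart_map c @` chart_dom c) (eta j).
  by apply: Cinfty_on_partial; exact: Cinfty_on_chart.
have /choice[B BE] : forall j, exists B : cinf M,
    \forall w \near x, (Y (pull ei (y j)) : cinf D) w = B (i w).
  by move=> j; have [_ i2 _ _] := ei; exact: i2.
pose b j := B j \o chart_inv c.
have Cb j : Cinfty_on (chart_map c @` chart_dom c) (b j) by exact: Cinfty_on_chart.
have T0 (p : 'rV[R]_n) : \forall z \near p, \sum_j tilt eta b j z * eta j z = 0.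
  by apply: (@nearW _ (nbhs p)) => z; exact: tilt_orth.
have [d d0 [gam gam0 dgam]] := level_curve ei Hi full dx
  (fun j => Cinfty_on_tilt j oO Ce Cb)
  (T0 (chart_map c (i x))).
have z0 : `|0 : R| < d by rewrite normr0.
pose good (w : D) : Prop := chart_dom c (i w) /\ [/\
    forall xi (phi : cinf D) (f : cinf M), tangent_vector w xi ->
      (\forall z \near w, phi z = f (i z)) ->
      xi phi = \sum_j xi (pull ei (y j)) *
        partial j (f \o chart_inv c) (chart_map c (i w)),
    forall xi, tangent_vector w xi ->
      \sum_j xi (pull ei (y j)) * eta j (chart_map c (i w)) = 0 &
    forall j, (Y (pull ei (y j)) : cinf D) w = B j (i w)].
have near_good : \forall w \near x, good w.
  have [_ _ ci _] := ei.
  have N1 : \forall w \near x, chart_dom c (i w).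
    exact: ci (chart_near_dom dx).
  have N4 : \forall w \near x, forall j, (Y (pull ei (y j)) : cinf D) w = B j (i w).
    exact: filter_forall.
  apply: filterI => //; apply: filterS2 (level_tangent_coord dx yE)
    (filterI (level_tangent_H dx yE) N4) => w E1 [E2 E3].
  by split.
have [_ c0 _] := dgam 0 z0; rewrite -gam0 in near_good.
have /nbhs_ballP[e e0 He] : nbhs (0 : R) (gam @^-1` [set w | good w]).
  exact: c0 _ near_good.
exists (Num.min d e); first by rewrite lt_min d0 e0.
exists gam, (fun t => \sum_k eta k (chart_map c (i (gam t))) ^+ 2).
split=> //; first by rewrite gam0; exact: (sum_eta_neq0 dx yE).
move=> t; rewrite lt_min => /andP[td te].
have [_ ct dt] := dgam t td; split=> // phi.
have [|dw [E1 E2 E3]] := He t; first by rewrite -ball_normE /= sub0r normrN.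
have [_ i2 _ _] := ei; have [f phif] := i2 phi (gam t).
have tY := vfield_tangent Y (gam t).
apply: (is_derive_eq (dt phi f phif)); rewrite tiltE.
have bE j : b j (chart_map c (i (gam t))) = (Y (pull ei (y j)) : cinf D) (gam t).
  by rewrite /b /= chartK // E3.
have -> : \sum_k b k (chart_map c (i (gam t))) * eta k (chart_map c (i (gam t))) = 0.
  by rewrite -[RHS](E2 _ tY); apply: eq_bigr => j _; rewrite bE.
rewrite mul0r subr0 (E1 _ phi f tY phif); congr (_ * _).
by apply: eq_bigr => j _; rewrite bE.
Qed.

(** A vector at [x] that does not kill [f] extends, after tilting, to nearby
    points with constant coefficients; the curves issued from these points show
    that it is tangent to the level there, and it still does not kill [f]. *)
Lemma noncritical_near (f : cinf D) : ~ critical f x ->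
  \forall w \near x, ~ critical f w.
Proof.
move=> /noncriticalP[xi txi xif].
have [c [y [dx yE]]] := level_chart.
have oO := @chart_open_image _ _ _ c.
have [_ i2 ci _] := ei; have [F fF] := i2 f x.
pose eta j := partial j (H \o chart_inv c).
have Ce j : Cinfty_on (chart_map c @` chart_dom c) (eta j).
  by apply: Cinfty_on_partial; exact: Cinfty_on_chart.
pose b j : 'rV[R]_n -> R := cst (xi (pull ei (y j))).
have Cb j : Cinfty_on (chart_map c @` chart_dom c) (b j) by exact: Cinfty_on_cst.
have Ct j := Cinfty_on_tilt j oO Ce Cb.
pose E z := \sum_j tilt eta b j z * partial j (F \o chart_inv c) z.
have CE : Cinfty_on (chart_map c @` chart_dom c) E.
  apply: Cinfty_on_sum => // j; apply: (Cinfty_onM oO (Ct j)).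
  by apply: Cinfty_on_partial; exact: Cinfty_on_chart.
have Op : (chart_map c @` chart_dom c) (chart_map c (i x)) by exists (i x).
have Ex : E (chart_map c (i x)) != 0.
  rewrite /E tiltE (nbhs_singleton (level_tangent_H dx yE) _ txi) mul0r subr0.
  rewrite mulf_neq0 //; first exact: (sum_eta_neq0 dx yE).
  by rewrite -(nbhs_singleton (level_tangent_coord dx yE) _ f F txi).
have nE : \forall w \near x, E (chart_map c (i w)) != 0.
  have cE : {for x, continuous (fun w => E (chart_map c (i w)))}.
    apply: (@continuous_comp _ _ _ (chart_map c \o i) E).
      by apply: continuous_comp; [exact: ci|exact: chart_map_continuous].
    exact: Cinfty_on_continuous CE Op.
  have N0 : nbhs (E (chart_map c (i x))) [set r : R | r != 0].
    by apply: open_nbhs_nbhs; split=> //; exact: open_neq.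
  exact: cE _ N0.
have nd : \forall w \near x, chart_dom c (i w) by exact: ci (chart_near_dom dx).
have T0 (p : 'rV[R]_n) : \forall z \near p, \sum_j tilt eta b j z * eta j z = 0.
  by apply: (@nearW _ (nbhs p)) => z; exact: tilt_orth.
apply: filterS3 nE nd (nbhs_interior fF) => w Ew dw fFw.
have [d d0 [gam gam0 dgam]] := level_curve ei Hi full dw Ct
  (T0 (chart_map c (i w))).
have z0 : `|0 : R| < d by rewrite normr0.
have [_ _ dg] := dgam 0 z0; rewrite gam0 in dg.
have dphi (phi : cinf D) : derivable (phi \o gam) 0 1.
  by have [g pg] := i2 phi w; have [] := dg phi g pg.
apply/noncriticalP; exists (fun phi => 'D_1 (phi \o gam) 0); last first.
  by have [_ ->] := dg f F fFw.
split=> [a u v|u v].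
  rewrite -[_ \o gam]/(a *: (u \o gam) + (v \o gam)) deriveD //.
    by rewrite deriveZ.
  exact: derivableZ.
rewrite -[_ \o gam]/((u \o gam) * (v \o gam)) deriveM //= gam0.
by rewrite addrC mulrC [X in _ + X]mulrC.
Qed.

End FieldCurves.

(** * Isolated critical circles of a Bott function *)

Section CriticalCircles.
Variables (R : realType) (D : smooth_space R) (n : nat) (f : cinf D).

(** In Bott coordinates the critical points are the points with w = 0, which
    contain the segment between any two of them. *)
Lemma bott_critical_near x : bott n f -> critical f x ->
  \forall y \near x, critical f y -> connected_component (critical f) x y.
Proof.
move=> bf cx; have [k [m [c [_ dx cP _]]]] := bf x cx.
set p := chart_map c x.
have [s [s0 sO _]] := chart_open_cube dx (@filterT _ (nbhs x) _).
have near_s : \forall y \near x, open_cube p s (chart_map c y).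
  have Np : nbhs p (open_cube p s).
    apply: open_nbhs_nbhs; split; first exact: open_open_cube.
    by rewrite /open_cube /= subrr normr0.
  exact: chart_map_continuous dx _ Np.
apply: filterS2 (chart_near_dom dx) near_s => y dy ys cy.
pose q (t : R) := p + t *: (chart_map c y - p).
have qO (t : R) : t \in `[0, 1] -> open_cube p s (q t).
  rewrite in_itv => t01.
  apply: le_lt_trans ys; apply: (cube_convex t01); rewrite /cube /=.
    by rewrite subrr normr0.
  by [].
have q1 : q 1 = chart_map c y by rewrite /q scale1r addrC subrK.
have q0 : q 0 = p by rewrite /q scale0r addr0.
have cq t : {for t, continuous q}.
  apply: differentiable_continuous; apply/derivable1_diffP.
  by have [] := is_derive_line p (chart_map c y - p) t.
exists ((chart_inv c \o q) @` `[0, 1]); last first.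
  by exists 1; [rewrite /= in_itv /= ler01 lexx|rewrite /= q1 chartK].
split.
- by exists 0; [rewrite /= in_itv /= ler01 lexx|rewrite /= q0 chartK].
- move=> _ [t t01 <-] /=; have Oq := sO _ (qO t t01).
  apply/(cP _ (chart_inv_dom Oq)); rewrite chart_mapK // /q.
  rewrite linearD linearZ linearB /=.
  have /(cP _ dx) -> := cx; have /(cP _ dy) -> := cy.
  by rewrite subrr scaler0 addr0.
- apply: connected_continuous_connected; first exact: segment_connected.
  apply: continuous_in_subspaceT => t; rewrite inE => t01.
  apply: continuous_comp; first exact: cq.
  by apply: chart_inv_continuous; exact/sO/qO.
Qed.

(** A critical point that lies near [x] and on a critical circle would put [x]
    on the same circle, as both are in one component of the critical set. *)
Lemma circles_complement_near x : bott n f ->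
  (~ critical f x -> \forall y \near x, ~ critical f y) ->
  circles_complement f x -> \forall y \near x, circles_complement f y.
Proof.
move=> bf nc Ax; have [cx|/nc] := pselect (critical f x); last first.
  apply: filterS => y ncy [C [[z cz ->] _]] /connected_component_sub.
  exact: ncy.
apply: filterS (bott_critical_near bf cx) => y xy [C CC Cy].
have [[z cz CE] _] := CC.
have cy : critical f y by move: Cy; rewrite CE => /connected_component_sub.
apply: Ax; exists C => //; rewrite CE.
apply: connected_component_trans (connected_component_sym (xy cy)).
by rewrite -CE.
Qed.

End CriticalCircles.

(** * Vertical fields on the punctured isoenergetic surface *)

Section Punctured.
Variables (R : realType) (S : isoenergetic_system R).
Variable f : cinf (phase_space S).
Local Notation M := (phase_space S).
Local Notation Q := (iso_surface S).
Local Notation F := (iso_restrict f).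
Local Notation D := (punctured_surface f).
Local Notation H := (hamiltonian S).

Let iQ : Q -> M := set_val.
Let iD : D -> M := iQ \o set_val.

Lemma iso_energy (x : Q) : H (iQ x) = energy S.
Proof. by have := set_valP x. Qed.

Lemma iso_full (x : Q) : \forall y \near iQ x, H y = energy S -> range iQ y.
Proof. by apply: (@nearW _ (nbhs (iQ x))) => y Hy;
  exists (SigSub (mem_set (Hy : [set x | H x = energy S] y))). Qed.

Hypothesis bF : bott 3 F.

Lemma circles_complement_open (x : Q) : circles_complement F x ->
  \forall y \near x, circles_complement F y.
Proof.
apply: (circles_complement_near bF).
apply: (noncritical_near (phase_space_manifold S) (sub_embedding _) iso_energy
  iso_full).
by apply: energy_regular; exact: iso_energy.
Qed.

Lemma punctured_full (x : D) : \forall y \near iD x, H y = energy S -> range iD y.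
Proof.
have Ax : circles_complement F (set_val x) by exact: set_valP.
have [_ _ _ i4] := sub_embedding [set x | H x = energy S].
have [V NV VA] := i4 _ _ (circles_complement_open Ax).
apply: filterS2 NV (iso_full (set_val x)) => y Vy yQ /yQ[q _ qy].
have Aq : circles_complement F q by apply: VA; rewrite /= -[set_val q]/(iQ q) qy.
by exists (SigSub (mem_set Aq)).
Qed.

Lemma embedding_punctured : embedding iD.
Proof. by apply: embedding_comp; exact: sub_embedding. Qed.

(** The integral curve through [x] stays on a level of [f] and is connected, so
    it is contained in the leaf of [x]. A function that vanishes on the leaf has
    derivative zero along the curve. The argument is the same at regular points,
    on singular leaves and on critical tori or Klein bottles. *)
Lemma vertical_of_integral (Y : vfield D) :
  (forall x, (Y (Defs.restrict (circles_complement F) F) : cinf D) x = 0) ->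
  vertical (@punctured_foliation _ _ f) Y.
Proof.
move=> YF K x [L [x0 [[z _ LE] Lx0 KE]]] Kx phi phi0.
have ncH : ~ critical H (iD x) by apply: energy_regular; exact: iso_energy.
have [d d0 [gam [k [gam0 k0 dgam]]]] := field_curve (phase_space_manifold S)
  embedding_punctured (fun y => iso_energy (set_val y)) punctured_full ncH Y.
have z0 : `|0 : R| < d by rewrite normr0.
pose G := Defs.restrict (circles_complement F) F.
have Ggam (t : R) : `|t| < d -> G (gam t) = G x.
  move=> td.
  have dG (s : R) : `|s| < d -> is_derive s (1 : R) (G \o gam) 0.
    move=> sd; have [_ /(_ G) H1] := dgam s sd.
    by apply: (is_derive_eq H1); rewrite YF mulr0.
  have M0 (s : R) : `|s| < d -> `|0 : R| <= 0 by rewrite normr0.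
  have := derive_bound dG M0 z0 td.
  by rewrite mul0r normr_le0 subr_eq0 /= gam0 => /eqP.
pose I : set R := [set` `[- (d / 2), d / 2]].
have Id t : I t -> `|t| < d.
  by rewrite /I /= in_itv /= ltr_norml => /andP[? ?]; apply/andP; split; lra.
have I0 : I 0 by rewrite /I /= in_itv /=; apply/andP; split; lra.
have cgam : connected (gam @` I).
  apply: connected_continuous_connected; first exact: segment_connected.
  apply: continuous_in_subspaceT => t; rewrite inE => /Id td.
  by have [] := dgam t td.
have cgam' : connected ((fun t => set_val (gam t) : Q) @` I).
  rewrite -[X in connected X](image_comp gam (set_val : D -> Q)).
  apply: connected_continuous_connected => //.
  by apply: continuous_subspaceT; exact: initial_continuous.
have LxL : L (set_val x) by move: Kx; rewrite KE => /connected_component_sub.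
have Lz : L = connected_component [set y | F y = F z] (set_val x).
  by move: LxL; rewrite -LE; exact: same_connected_component.
have Fx : F (set_val x) = F z.
  by move: LxL; rewrite -LE => /connected_component_sub.
have gamL : (fun t => set_val (gam t) : Q) @` I `<=` L.
  rewrite Lz; apply: connected_component_max => //.
    by exists 0 => //; rewrite gam0.
  by move=> _ [t /Id td <-]; exact: etrans (Ggam t td) Fx.
have gamK : gam @` I `<=` K.
  move: Kx; rewrite KE => /same_connected_component ->.
  apply: connected_component_max => //; first by exists 0.
  by move=> _ [t It <-] /=; apply: gamL; exists t.
have [_ /(_ phi)[_]] := dgam 0 z0.
rewrite gam0 (near_eq_derive (g := cst 0)) ?derive_cst.
  by move=> /esym/eqP; rewrite mulf_eq0 (negPf k0) /= => /eqP.
have d20 : `|0 : R| < d / 2 by rewrite normr0 divr_gt0.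
apply: filterS (near_norm_lt d20) => t; rewrite ltr_norml => /andP[t1 t2] /=.
by apply/phi0/gamK; exists t => //; rewrite /I /= in_itv /= !ltW.
Qed.

End Punctured.

(** * Diffeomorphisms and the transport of fields *)

Section Diffeos.
Variable R : realType.
Implicit Types D E : smooth_space R.

Definition diffeo_sym D E (g : diffeo D E) : diffeo E D :=
  Diffeo (diffeoVK g) (diffeoK g) (@diffeo_inv_continuous _ _ _ g)
    (@diffeo_continuous _ _ _ g) (diffeo_inv_smooth g) (diffeo_smooth g).

Lemma diffeo_imageVK D E (g : diffeo D E) (T : set E) :
  g @` (diffeo_inv g @` T) = T.
Proof.
apply/seteqP; split=> [_ [_ [x Tx <-] <-]|x Tx]; first by rewrite diffeoVK.
by exists (diffeo_inv g x); [exists x|rewrite diffeoVK].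
Qed.

Section SubDiffeo.
Variables (D E : smooth_space R) (g : diffeo D E) (A : set D) (B : set E).
Hypothesis AB : forall x, A x <-> B (g x).

Let fwd (x : sub_space A) : sub_space B :=
  SigSub (mem_set ((AB _).1 (set_valP x) : B (g (set_val x)))).

Let bwdP (y : sub_space B) : A (diffeo_inv g (set_val y)).
Proof. by apply/(AB _).2; rewrite diffeoVK; exact: set_valP. Qed.

Let bwd (y : sub_space B) : sub_space A := SigSub (mem_set (bwdP y)).

Let fwdK : cancel fwd bwd.
Proof. by move=> x; apply/val_inj; rewrite /= diffeoK. Qed.

Let bwdK : cancel bwd fwd.
Proof. by move=> x; apply/val_inj; rewrite /= diffeoVK. Qed.

Let fwd_continuous : continuous fwd.
Proof.
have [_ _ _ i4] := sub_embedding B; have [_ _ c _] := sub_embedding A.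
move=> x U /i4[V NV VU].
have : \forall y \near x, V (g (set_val y)).
  exact: c _ _ (@diffeo_continuous _ _ _ g _ _ NV).
by apply: filterS => y Vy; apply: VU.
Qed.

Let bwd_continuous : continuous bwd.
Proof.
have [_ _ _ i4] := sub_embedding A; have [_ _ c _] := sub_embedding B.
move=> x U /i4[V NV VU].
have : \forall y \near x, V (diffeo_inv g (set_val y)).
  exact: c _ _ (@diffeo_inv_continuous _ _ _ g _ _ NV).
by apply: filterS => y Vy; apply: VU.
Qed.

Let fwd_smooth (f : cinf (sub_space B)) : smooth (f \o fwd).
Proof.
move=> x; have [h hs fh] := cinfP f (fwd x).
exists (h \o g); first exact: (diffeo_smooth g (mk_cinf hs)).
exact: fwd_continuous fh.
Qed.

Let bwd_smooth (f : cinf (sub_space A)) : smooth (f \o bwd).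
Proof.
move=> x; have [h hs fh] := cinfP f (bwd x).
exists (h \o diffeo_inv g); first exact: (diffeo_inv_smooth g (mk_cinf hs)).
exact: bwd_continuous fh.
Qed.

(** The points of a subspace carry membership proofs, so the restriction is
    rebuilt from its action on the underlying points. *)
Definition sub_diffeo : diffeo (sub_space A) (sub_space B) :=
  Diffeo fwdK bwdK fwd_continuous bwd_continuous fwd_smooth bwd_smooth.

End SubDiffeo.

Section Pullback.
Variables (D E : smooth_space R) (g : diffeo D E).

Lemma pullbackZD (a : R) (u v : cinf E) :
  pullback g (a *: u + v) = a *: pullback g u + pullback g v.
Proof. exact/val_inj/funext. Qed.

Lemma pullbackD (u v : cinf E) : pullback g (u + v) = pullback g u + pullback g v.
Proof. exact/val_inj/funext. Qed.

Lemma pullbackM (u v : cinf E) : pullback g (u * v) = pullback g u * pullback g v.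
Proof. exact/val_inj/funext. Qed.

Lemma pullbackK (u : cinf E) : pullback (diffeo_sym g) (pullback g u) = u.
Proof.
apply/val_inj/funext => y; rewrite -[LHS]/(u (g (diffeo_inv g y))).
by rewrite diffeoVK.
Qed.

Lemma pullbackVK (u : cinf D) : pullback g (pullback (diffeo_sym g) u) = u.
Proof.
apply/val_inj/funext => y; rewrite -[LHS]/(u (diffeo_inv g (g y))).
by rewrite diffeoK.
Qed.

End Pullback.

Section PushField.
Variables (D E : smooth_space R) (g : diffeo D E).

Fact push_derivation (X : vfield D) :
  derivation (fun phi : cinf E => pullback (diffeo_sym g) (X (pullback g phi))).
Proof.
have [Xl XM] := vfieldP X; split=> [a u v|u v].
  by rewrite pullbackZD Xl pullbackZD.
by rewrite pullbackM XM pullbackD !pullbackM !pullbackK.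
Qed.

Definition push_field (X : vfield D) : vfield E :=
  VField (introT (asboolP _) (push_derivation X)).

Lemma push_fieldE X phi y :
  (push_field X phi : cinf E) y = (X (pullback g phi) : cinf D) (diffeo_inv g y).
Proof. by []. Qed.

End PushField.

Lemma manifold_smooth_continuous (M : smooth_space R) n (f : cinf M) :
  manifold M n -> continuous f.
Proof.
move=> [_ _ ch] x; have [c dx] := ch x.
have cf : {for x, continuous ((f \o chart_inv c) \o chart_map c)}.
  apply: continuous_comp; first exact: chart_map_continuous.
  by apply: Cinfty_on_continuous (Cinfty_on_chart c f) _; exists x.
have fE : \forall y \near x, ((f \o chart_inv c) \o chart_map c) y = f y.
  by apply: filterS (chart_near_dom dx) => y dy /=; rewrite chartK.
rewrite /prop_for /continuous_at -(nbhs_singleton fE).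
exact: cvg_trans (near_eq_cvg fE) cf.
Qed.

(** Smooth functions of an abstract smooth space need not be continuous; here
    continuity comes from the charts. *)
Lemma embedding_smooth_continuous D (M : smooth_space R) n (i : D -> M)
    (f : cinf D) :
  manifold M n -> embedding i -> continuous f.
Proof.
move=> mM [_ i2 ci _] x; have [h fh] := i2 f x.
have hf : \forall y \near x, (h \o i) y = f y by apply: filterS fh => y /esym.
have ch : {for x, continuous (h \o i)}.
  apply: continuous_comp; first exact: ci.
  exact: manifold_smooth_continuous mM _.
rewrite /prop_for /continuous_at -(nbhs_singleton hf).
exact: cvg_trans (near_eq_cvg hf) ch.
Qed.

End Diffeos.

(** * Vertical fields under a topological equivalence *)

Section Equivalence.
Variables (R : realType) (S1 S2 : isoenergetic_system R).
Variables (f1 : cinf (phase_space S1)) (f2 : cinf (phase_space S2)).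
Local Notation F1 := (iso_restrict f1).
Local Notation F2 := (iso_restrict f2).
Local Notation D1 := (punctured_surface f1).
Local Notation D2 := (punctured_surface f2).
Variable g : diffeo (iso_surface S1) (iso_surface S2).

Lemma circles_complement_diffeo :
  (forall C, critical_circle F1 C <-> critical_circle F2 (g @` C)) ->
  forall x, circles_complement F1 x <-> circles_complement F2 (g x).
Proof.
move=> gC x; split=> nx [C CC Cx]; apply: nx.
  exists (diffeo_inv g @` C).
    by apply/gC; rewrite diffeo_imageVK.
  by exists (g x) => //; rewrite diffeoK.
by exists (g @` C); [exact/gC|exists x].
Qed.

Hypothesis gT : forall T, liouville_torus F1 T <-> liouville_torus F2 (g @` T).
Hypothesis gA : forall x, circles_complement F1 x <-> circles_complement F2 (g x).
Hypothesis bF2 : bott 3 F2.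
Hypothesis nres2 : nonresonant f2.

(** On a torus [T] without critical points, the function F2 is constant, so
    F2 o g is constant on the preimage of [T], which is a leaf of [F1] even if it
    is a critical torus. Hence the pushed field kills F2 on [T], and everywhere,
    since these tori are dense and the result is continuous. *)
Lemma push_vertical (X : vfield D1) : vertical (@punctured_foliation _ _ f1) X ->
  vertical (@punctured_foliation _ _ f2) (push_field (sub_diffeo gA) X).
Proof.
move=> vX; apply: (vertical_of_integral bF2) => y.
set psi := (push_field _ _ _ : cinf D2).
apply: contrapT => /eqP psiy.
have cpsi : continuous psi.
  exact: embedding_smooth_continuous (phase_space_manifold S2)
    (embedding_punctured f2).
have NU : \forall z \near y, psi z != 0.
  have N0 : nbhs (psi y) [set r : R | r != 0].
    by apply: open_nbhs_nbhs; split=> //; exact: open_neq.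
  exact: cpsi _ _ N0.
have [_ _ _ i4] := sub_embedding (circles_complement F2).
have [V NV VU] := i4 _ _ NU.
move: NV; rewrite nbhsE => -[W [oW Wy] WV].
have [q [Wq [T [rT _] Tq]]] := nres2 (ex_intro _ _ Wy) oW.
have [[z _ TE] Tc] := rT.
have Aq : circles_complement F2 q.
  move=> [C [[x _ ->] _] /connected_component_sub cq].
  by have : (T `&` critical F2) q by []; rewrite Tc.
pose w : D2 := SigSub (mem_set Aq).
have /negP := VU w (WV _ Wq); apply; apply/eqP.
rewrite /psi push_fieldE; set x := diffeo_inv _ w.
have LT1 : liouville_foliation F1 (diffeo_inv g @` T).
  have : liouville_torus F1 (diffeo_inv g @` T).
    by apply/gT; rewrite diffeo_imageVK; left.
  by case=> [[]|[]].
have Tx : (diffeo_inv g @` T) (set_val x) by exists q.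
have FT u : T u -> F2 u = F2 q.
  move: Tq; rewrite -TE => /connected_component_sub Hq /connected_component_sub Hu.
  exact: etrans Hu (esym Hq).
have Kx : connected_component (set_val @^-1` (diffeo_inv g @` T)) x x.
  exact: connected_component_refl.
have tX := vfield_tangent X x.
pose phi := pullback (sub_diffeo gA) (Defs.restrict (circles_complement F2) F2).
have := vX _ x _ Kx (phi - F2 q *: (1 : cinf D1)).
rewrite -/phi (tangentB tX) (tangentZ tX) (tangent1 tX) mulr0 subr0; apply.
  by exists (diffeo_inv g @` T), x.
move=> v /connected_component_sub[u Tu uE].
rewrite -[LHS]/(F2 (g (set_val v)) - F2 q * (1 : R)) mulr1 -uE diffeoVK.
by rewrite FT // subrr.
Qed.

End Equivalence.

(** * Invariance of the vertical cohomology *)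

Section QuotientIso.
Variables (K : pzRingType) (V W : lmodType K).
Variables (I : zmodClosed V) (IZ : GRing.scaler_closed I).
Variables (J : zmodClosed W) (JZ : GRing.scaler_closed J).
Variables (u : V -> W) (v : W -> V).
Hypotheses (lu : linear u) (uK : cancel u v) (vK : cancel v u).
Hypotheses (uI : forall x, x \in I -> u x \in J)
  (vJ : forall y, y \in J -> v y \in I).
Local Open Scope quotient_scope.

Let uB x y : u (x - y) = u x - u y.
Proof. by rewrite -[x - y]addrC -scaleN1r lu scaleN1r addrC. Qed.

Let vB x y : v (x - y) = v x - v y.
Proof. by rewrite -[RHS]uK uB !vK. Qed.

Let pi_eq (L : lmodType K) (N : zmodClosed L) (x y : L) :
  (x - y \in N) = (\pi_(Quotient.quot N) x == \pi_(Quotient.quot N) y).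
Proof. exact: Quotient.idealrBE. Qed.

Let phi (q : mod_quot IZ) : mod_quot JZ :=
  \pi_(Quotient.quot J) (u (repr (q : Quotient.quot I))).
Let psi (q : mod_quot JZ) : mod_quot IZ :=
  \pi_(Quotient.quot I) (v (repr (q : Quotient.quot J))).

Let phiE x : phi (\pi_(Quotient.quot I) x) = \pi_(Quotient.quot J) (u x).
Proof. by apply/eqP; rewrite /phi -pi_eq -uB; apply: uI; rewrite pi_eq reprK. Qed.

Let psiE y : psi (\pi_(Quotient.quot J) y) = \pi_(Quotient.quot I) (v y).
Proof. by apply/eqP; rewrite /psi -pi_eq -vB; apply: vJ; rewrite pi_eq reprK. Qed.

Let piZD (L : lmodType K) (N : zmodClosed L) (NZ : GRing.scaler_closed N) a
    (x y : L) :
  \pi_(Quotient.quot N) (a *: x + y) =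
    a *: (\pi_(Quotient.quot N) x : mod_quot NZ) + \pi_(Quotient.quot N) y.
Proof.
rewrite -[RHS]/(mod_quot_scale a (\pi_(Quotient.quot N) x : mod_quot NZ) + _).
rewrite mod_quot_scaleE.
by rewrite -[RHS]/(\pi_(Quotient.quot N) _ + \pi_(Quotient.quot N) _) !piE.
Qed.

Let phi_linear : linear phi.
Proof.
move=> a x y; rewrite -[x](@reprK _ (Quotient.quot I)) -[y](@reprK _ (Quotient.quot I)).
by rewrite -piZD !phiE lu piZD.
Qed.

Lemma mod_quot_iso : exists f : {linear mod_quot IZ -> mod_quot JZ}, bijective f.
Proof.
pose lin := GRing.isLinear.Build K (mod_quot IZ) (mod_quot JZ) *:%R phi phi_linear.
pose f : {linear mod_quot IZ -> mod_quot JZ} := HB.pack phi lin.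
exists f; exists psi => q.
  by rewrite -[q](@reprK _ (Quotient.quot I)) /= phiE psiE uK.
by rewrite -[q](@reprK _ (Quotient.quot J)) /= psiE phiE vK.
Qed.

End QuotientIso.

Section Transport.
Variables (R : realType) (D E : smooth_space R) (g : diffeo D E).
Variables (P : set (set D)) (P' : set (set E)).
Hypothesis vg : forall Y : vfield E, vertical P' Y ->
  vertical P (push_field (diffeo_sym g) Y).
Local Notation gV := (diffeo_sym g).

Definition pull_vert (Y : vert P') : vert P :=
  Vert (introT (asboolP _) (vg (@vertP _ _ _ Y))).

Lemma pull_vertE Y phi : pull_vert Y phi = pullback g (Y (pullback gV phi)).
Proof. exact/val_inj/funext. Qed.

Lemma eq_vert (D' : smooth_space R) (L : set (set D')) (X Y : vert L) :
  (forall phi, X phi = Y phi) -> X = Y.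
Proof. by move=> XY; apply/val_inj/val_inj/funext. Qed.

Lemma pull_vertZD a Y Z :
  pull_vert (a *: Y + Z) = pullback g a *: pull_vert Y + pull_vert Z.
Proof.
apply: eq_vert => phi; rewrite pull_vertE.
rewrite -[LHS]/(pullback g (a * (Y (pullback gV phi)) + Z (pullback gV phi))).
rewrite pullbackD pullbackM.
by rewrite -[RHS]/(pullback g a * pull_vert Y phi + pull_vert Z phi) !pull_vertE.
Qed.

Lemma pull_vbracket Y Z :
  pull_vert (vbracket Y Z) = vbracket (pull_vert Y) (pull_vert Z).
Proof.
apply: eq_vert => phi; rewrite pull_vertE.
rewrite -[RHS]/(pull_vert Y (pull_vert Z phi) - pull_vert Z (pull_vert Y phi)).
rewrite !pull_vertE !pullbackK.
exact/val_inj/funext.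
Qed.

Definition transport p (alpha : cochain P p) : cochain P' p :=
  fun Y => pullback gV (alpha (fun k => pull_vert (Y k))).

Lemma transport_linear p : linear (@transport p).
Proof. by move=> a u v; apply/funext => Y; exact: pullbackZD. Qed.

Lemma transport_form p (alpha : cochain P p) :
  Defs.form alpha -> Defs.form (transport alpha).
Proof.
move=> [al aa]; have set_argE X i Y : (fun k => pull_vert (set_arg X i Y k)) =
    set_arg (fun k : 'I_p => pull_vert (X k)) i (pull_vert Y).
  by apply/funext => k; rewrite /set_arg; case: ifP.
split=> [X i a Y Z|X i j ij Xij]; rewrite /transport.
  by rewrite !set_argE pull_vertZD al pullbackD pullbackM pullbackK.
by rewrite (aa _ i j) ?Xij //; exact/val_inj/funext.
Qed.

Lemma pullback_sum (D' E' : smooth_space R) (k : diffeo D' E') (I : Type)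
    (r : seq I) (Q : pred I) (F : I -> cinf E') :
  pullback k (\sum_(i <- r | Q i) F i) = \sum_(i <- r | Q i) pullback k (F i).
Proof.
elim/big_rec2: _ => [|i u v _ <-]; first exact/val_inj/funext.
by rewrite pullbackD.
Qed.

Lemma pullback_sign (D' E' : smooth_space R) (k : diffeo D' E') m :
  pullback k ((-1) ^+ m) = (-1) ^+ m.
Proof.
elim: m => [|m IHm]; first exact/val_inj/funext.
by rewrite !exprS pullbackM IHm; congr (_ * _); exact/val_inj/funext.
Qed.

Lemma transport_dF p (alpha : cochain P p) :
  dF (transport alpha) = transport (dF alpha).
Proof.
apply/funext => Y; rewrite /transport /dF pullbackD !pullback_sum; congr (_ + _).
  apply: eq_bigr => i _; rewrite pullbackM pullback_sign pull_vertE; congr (_ * _).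
  by rewrite pullbackK.
apply: eq_bigr => i _; rewrite pullback_sum; apply: eq_bigr => j _.
rewrite pullbackM pullback_sign; congr (_ * pullback _ (alpha _)).
by apply/funext => k; case: ifP => // _; rewrite pull_vbracket.
Qed.

Lemma transport_cocycle p (alpha : cochain P p) :
  cocycle alpha -> cocycle (transport alpha).
Proof.
move=> [fa da]; split; first exact: transport_form.
rewrite transport_dF da; apply/funext => Y; exact/val_inj/funext.
Qed.

Lemma transport_exact p (alpha : cochain P p) :
  exact_form alpha -> exact_form (transport alpha).
Proof.
case: p alpha => [|p] alpha /=.
  by move=> ->; apply/funext => Y; exact/val_inj/funext.
by move=> [b fb ->]; exists (transport b); [exact: transport_form|rewrite transport_dF].
Qed.

Definition transport_cocycles p (alpha : cocycles P p) : cocycles P' p :=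
  Cocycle (introT (asboolP _) (transport_cocycle
    (elimT (asboolP _) (valP alpha : cocycle_pred _)))).

End Transport.

Section Invariance.
Variables (R : realType) (D E : smooth_space R) (g : diffeo D E).
Variables (P : set (set D)) (P' : set (set E)).
Hypothesis vg : forall X : vfield D, vertical P X -> vertical P' (push_field g X).
Hypothesis vgV : forall Y : vfield E, vertical P' Y ->
  vertical P (push_field (diffeo_sym g) Y).

Let vg' (X : vfield D) : vertical P X ->
  vertical P' (push_field (diffeo_sym (diffeo_sym g)) X).
Proof.
move=> /vg vX L x PL Lx phi phi0; rewrite -[RHS](vX L x PL Lx phi phi0).
by rewrite !push_fieldE; congr ((X _ : cinf D) _).
Qed.

Let pullSS (u : cinf D) :
  pullback (diffeo_sym (diffeo_sym g)) (pullback (diffeo_sym g) u) = u.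
Proof. exact: pullbackK. Qed.

Let transportK p : cancel (@transport _ _ _ g P P' vgV p)
  (@transport _ _ _ (diffeo_sym g) P' P vg' p).
Proof.
move=> alpha; apply/funext => X; rewrite /transport pullSS; congr (alpha _).
apply/funext => k; apply: eq_vert => phi; rewrite !pull_vertE pullbackVK.
congr (vert_vfield (X k) _); exact: pullbackVK.
Qed.

Let transportVK p : cancel (@transport _ _ _ (diffeo_sym g) P' P vg' p)
  (@transport _ _ _ g P P' vgV p).
Proof.
move=> alpha; apply/funext => X; rewrite /transport.
rewrite [LHS](pullbackK g); congr (alpha _).
apply/funext => k; apply: eq_vert => phi; rewrite !pull_vertE pullbackK.
congr (vert_vfield (X k) _); exact: pullbackK.
Qed.

Lemma vertical_cohomology_iso p :
  exists phi : {linear vertical_cohomology P p -> vertical_cohomology P' p},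
    bijective phi.
Proof.
apply: (@mod_quot_iso R (cocycles P p) (cocycles P' p) _ _ _ _
  (@transport_cocycles _ _ _ g P P' vgV p)
  (@transport_cocycles _ _ _ (diffeo_sym g) P' P vg' p)).
- by move=> a u v; apply/val_inj; exact: transport_linear.
- by move=> u; apply/val_inj; exact: transportK.
- by move=> u; apply/val_inj; exact: transportVK.
- by move=> u /asboolP eu; apply/asboolP; exact: transport_exact.
- by move=> u /asboolP eu; apply/asboolP; exact: transport_exact.
Qed.

End Invariance.

Theorem theorem3p3 (R : realType) (S1 S2 : isoenergetic_system R)
    (f1 : cinf (phase_space S1)) (f2 : cinf (phase_space S2))
    (f1_bott : bott_integral f1) (f2_bott : bott_integral f2)
    (f1_nonres : nonresonant f1) (f2_nonres : nonresonant f2)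
    (equiv : topologically_equivalent f1 f2) (p : nat) (hp : (p <= 2)%N) :
  exists phi : {linear iso_cohomology f1 p -> iso_cohomology f2 p},
    bijective phi.
Proof.
have [_ _ _ bF1] := f1_bott; have [_ _ _ bF2] := f2_bott.
have [g [_ gT gC _]] := equiv.
have gA := circles_complement_diffeo gC.
have gAV x : circles_complement (iso_restrict f2) x <->
    circles_complement (iso_restrict f1) (diffeo_sym g x).
  by rewrite (gA (diffeo_sym g x)) /= diffeoVK.
have gTV T : liouville_torus (iso_restrict f2) T <->
    liouville_torus (iso_restrict f1) (diffeo_sym g @` T).
  by rewrite gT [g @` _](diffeo_imageVK g T).
apply: (vertical_cohomology_iso (g := sub_diffeo gA)).
  exact: push_vertical.
move=> Y /(push_vertical gTV gAV bF1 f1_nonres) vY L x PL Lx phi phi0.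
rewrite -[RHS](vY L x PL Lx phi phi0) !push_fieldE.
have -> : pullback (diffeo_sym (sub_diffeo gA)) phi = pullback (sub_diffeo gAV) phi.
  by apply/val_inj/funext => y; congr (phi _); exact/val_inj.
by congr ((Y _ : cinf _) _); exact/val_inj.
Qed.
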